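(* Let $R$ be the endomorphism ring of an elliptic curve, let $H$ be a finite subgroup of $GL(2,R)$ with $$H\cap SL(2,R)=\langle g\rangle\simeq C_6,$$ and let $h_o\in H$ be an element of order $r$ with $\det(H)=\langle\det(h_o)\rangle\simeq C_s$, $s>1$, and eigenvalues $\lambda_1(h_o),\lambda_2(h_o)$. Then $H$ is isomorphic to some $H_{C6}(i)$, $1\leq i\leq7$, where $H_{C6}(1)=\langle h_o\rangle\simeq C_{12}$ with $R=\mathbb{Z}[i]$, $\lambda_1(h_o)=e^{\frac{\pi i}{6}}$, $\lambda_2(h_o)=e^{\frac{5\pi i}{6}}$; $H_{C6}(2)=\langle g\rangle\times\langle h_o\rangle\simeq C_6\times C_2$ with $R=\mathcal{O}_{-3}$ or $R=R_{-3,2}$, $\lambda_1(h_o)=-1$, $\lambda_2(h_o)=1$; $H_{C6}(3)=\langle g,h_o\mid g^3=-I_2,\ h_o^2=I_2,\ h_ogh_o^{-1}=g^{-1}\rangle\simeq\mathcal{D}_6$ is the dihedral group of order $12$, $\lambda_1(h_o)=-1$, $\lambda_2(h_o)=1$; $H_{C6}(4)=\langle g\rangle\times\langle e^{\frac{2\pi i}{3}}I_2\rangle\simeq C_6\times C_3$ with $R=\mathcal{O}_{-3}$ and any $g\in SL(2,\mathcal{O}_{-3})$ of $\mathrm{tr}(g)=1$; $H_{C6}(5)=\langle g,h_o\mid g^3=h_o^4=-I_2,\ h_ogh_o^{-1}=g^{-1}\rangle$ of order $24$ with $R=\mathbb{Z}[i]$, $\lambda_1(h_o)=e^{\frac{3\pi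 i}{4}}$, $\lambda_2(h_o)=e^{-\frac{\pi i}{4}}$; $H_{C6}(6)=\langle g,h_o\mid g^3=-I_2,\ h_o^6=I_2,\ h_ogh_o^{-1}=g^{-1}\rangle$ of order $36$ with $R=\mathcal{O}_{-3}$, $\lambda_1(h_o)=e^{\frac{2\pi i}{3}}$, $\lambda_2(h_o)=e^{-\frac{\pi i}{3}}$; $H_{C6}(7)=\langle g\rangle\times\langle h_o\rangle\simeq C_6\times C_6$ of order $36$ with $R=\mathcal{O}_{-3}$, $\lambda_1(h_o)=e^{\frac{2\pi i}{3}}$, $\lambda_2(h_o)=e^{-\frac{\pi i}{3}}$. There exist subgroups $H_{C6}(1)<GL(2,\mathbb{Z}[i])$, $H_{C6}(2),H_{C6}(4),H_{C6}(7)<GL(2,\mathcal{O}_{-3})$, as well as subgroups $H^o_{C6}(3)<GL(2,\mathbb{Q}(\sqrt{-d}))$, $H^o_{C6}(5)<GL(2,\mathbb{Q}(\sqrt2,i))$, $H^o_{C6}(6)<GL(2,\mathbb{Q}(\sqrt{-3}))$ with $H^o_{C6}(j)\simeq H_{C6}(j)$ for $j\in\{3,5,6\}$.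
   Context: $R=\mathrm{End}(E)$ for a complex elliptic curve $E$; thus $R=\mathbb{Z}$ or $R=R_{-d,f}=\mathbb{Z}+f\mathcal{O}_{-d}\subset\mathbb{C}$ with a conductor $f\in\mathbb{N}$ and $\mathcal{O}_{-d}$ the integers ring of an imaginary quadratic field $\mathbb{Q}(\sqrt{-d})$; in particular $R_{-3,2}=\mathbb{Z}+\sqrt{-3}\,\mathbb{Z}$. In all cases $R\subset\mathbb{Q}(\sqrt{-d})$ (for $R=\mathbb{Z}$, with any $d\in\mathbb{N}$). $GL(2,R)=\{g\in R_{2\times2}:\det(g)\in R^*\}$, $SL(2,R)$ is its subgroup of matrices of determinant $1$, and $C_n$ is the cyclic group of order $n$. In the list, $g$ denotes an element of order $6$ of $SL(2,R)$ (equivalently, of trace $1$, and then $g^3=-I_2$) and $h_o$ an element of $GL(2,R)$ of finite order with the indicated eigenvalues; ''with $R=\dots$'' means that the case is listed only for that ring. *)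

(* Defs.v *)
From HB Require Import structures.
From mathcomp Require Import all_boot all_order all_fingroup all_algebra.
From mathcomp Require Import all_solvable.
From mathcomp Require Import complex.
From mathcomp Require Import boolp classical_sets functions cardinality.
From mathcomp Require Import reals trigo.

Set Implicit Arguments.
Unset Strict Implicit.
Unset Printing Implicit Defensive.

Import Order.TTheory GRing.Theory Num.Theory.

Local Open Scope ring_scope.
Local Open Scope complex_scope.
Local Open Scope classical_set_scope.

Section UnitSubgroups.
Context {A : unitRingType}.
Implicit Types (H P Q : set A) (x y : A).

Definition is_subgroup H : Prop :=
  [/\ forall x, H x -> x \is a GRing.unit,
      H 1,
      forall x y, H x -> H y -> H (x * y)
    & forall x, H x -> H x^-1].

Definition generated (S : set A) : set A := smallest is_subgroup S.

Definition cyclic_gen x : set A := [set x ^ n | n in [set: int]].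

Definition has_order x (n : nat) : Prop :=
  [/\ (0 < n)%N, x ^+ n = 1 & forall m, (0 < m < n)%N -> x ^+ m != 1].

Definition is_dprod P Q H : Prop :=
  [/\ H = [set x * y | x in P & y in Q],
      P `&` Q = [set 1]
    & forall x y, P x -> Q y -> x * y = y * x].

Definition isomorphic H (gT : finGroupType) (G : {set gT}) : Prop :=
  exists f : gT -> A,
    [/\ {in G &, injective f},
        {in G &, forall a b, f (a * b)%g = f a * f b}
      & f @` [set` G] = H].

(* The relations of the next three presentations mention -I_2, which is not a
   generator: the letter z stands for it, with the relations saying that it is
   central of square 1. The letters x and y stand for g and h_o. *)

Definition presented3 H : Prop :=
  exists (gT : finGroupType) (G : {group gT}),
    isomorphic H G /\
    (G \isog Grp (x : y : z : (z ^+ 2, [~ z, x], [~ z, y],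
                               x ^+ 3 = z, y ^+ 2, y * x * y^-1 = x^-1)))%g.

Definition presented5 H : Prop :=
  exists (gT : finGroupType) (G : {group gT}),
    isomorphic H G /\
    (G \isog Grp (x : y : z : (z ^+ 2, [~ z, x], [~ z, y],
                               x ^+ 3 = y ^+ 4 = z, y * x * y^-1 = x^-1)))%g.

Definition presented6 H : Prop :=
  exists (gT : finGroupType) (G : {group gT}),
    isomorphic H G /\
    (G \isog Grp (x : y : z : (z ^+ 2, [~ z, x], [~ z, y],
                               x ^+ 3 = z, y ^+ 6, y * x * y^-1 = x^-1)))%g.

End UnitSubgroups.

Section Corollary.
Context {K : realType}.
Local Notation C := K[i].

Definition lattice (w1 w2 : C) : set C :=
  [set a%:~R * w1 + b%:~R * w2 | a in [set: int] & b in [set: int]].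

(* The elliptic curve is E = C / (Z w1 + Z w2); its endomorphisms are induced
   by the multiplications z |-> a z preserving the lattice, which identifies
   End(E) with a subring of C. *)
Definition is_elliptic_End (R : set C) : Prop :=
  exists w1 w2 : C,
    (forall a b : K, a%:C * w1 + b%:C * w2 = 0 -> a = 0 /\ b = 0) /\
    R = [set a | forall z, lattice w1 w2 z -> lattice w1 w2 (a * z)].

Definition is_subfield (F : set C) : Prop :=
  [/\ F 1, forall x y, F x -> F y -> F (x - y)
    & forall x y, F x -> F y -> F (x / y)].

Definition Q_adjoin (S : set C) : set C := smallest is_subfield S.

Definition sqrtN (d : nat) : C := 0 +i* Num.sqrt (d%:R : K).

Definition Q_sqrtN (d : nat) : set C := Q_adjoin [set sqrtN d].

Definition Q_sqrt2_i : set C := Q_adjoin [set (Num.sqrt (2 : K))%:C; 0 +i* 1].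

Definition ring_of_integers (d : nat) : set C :=
  [set x | Q_sqrtN d x /\ integralOver (intr : int -> C) x].

(* The order Z + f O_{-d} of conductor f. *)
Definition quad_order (d f : nat) : set C :=
  [set m%:~R + f%:R * x | m in [set: int] & x in ring_of_integers d].

Definition gaussian_integers : set C :=
  [set a%:~R +i* b%:~R | a in [set: int] & b in [set: int]].

Definition units_in (R : set C) : set C :=
  [set u | R u /\ exists2 v, R v & u * v = 1].

Definition GL2 (R : set C) : set 'M[C]_2 :=
  [set g : 'M[C]_2 | (forall i j, R (g i j)) /\ units_in R (\det g)].

Definition SL2 (R : set C) : set 'M[C]_2 :=
  [set g : 'M[C]_2 | GL2 R g /\ \det g = 1].

Definition finite_subgroup (H G : set 'M[C]_2) : Prop :=
  [/\ is_subgroup H, H `<=` G & finite_set H].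

Definition eigenvalues (h : 'M[C]_2) (l1 l2 : C) : Prop :=
  char_poly h = ('X - l1%:P) * ('X - l2%:P).

(* exp (t i) *)
Definition cis (t : K) : C := cos t +i* sin t.

Definition C6_setting (R : set C) (H : set 'M[C]_2) (g h : 'M[C]_2) : Prop :=
  [/\ finite_subgroup H (GL2 R),
      H `&` SL2 R = cyclic_gen g,
      isomorphic (cyclic_gen g) (Zp 6),
      H h
    & determinant @` H = cyclic_gen (\det h)].

(* HC6 i R H g h : the subgroup H of GL(2, R) is the group H_{C6}(i), with g and
   h = h_o as the elements named in its description. If H is given with some
   element h_o whose determinant generates det(H), the h that fits the
   description is in general another such element of H: for instance the
   eigenvalues of h_o and g h_o differ, although both are admissible. *)
Definition HC6 (i : nat) (R : set C) (H : set 'M[C]_2) (g h : 'M[C]_2) : Prop :=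
  match i with
  | 1%N => [/\ H = cyclic_gen h, isomorphic H (Zp 12),
             R = gaussian_integers
           & eigenvalues h (cis (pi / 6)) (cis (5 * pi / 6))]
  | 2%N => [/\ is_dprod (cyclic_gen g) (cyclic_gen h) H,
             isomorphic H (finset.setX (Zp 6) (Zp 2)),
             R = ring_of_integers 3 \/ R = quad_order 3 2
           & eigenvalues h (-1) 1]
  | 3%N => [/\ H = generated [set g; h],
             [/\ g ^+ 3 = -1, h ^+ 2 = 1 & h * g * h^-1 = g^-1],
             presented3 H, isomorphic H ('D_12)%g
           & eigenvalues h (-1) 1]
  | 4%N => [/\ is_dprod (cyclic_gen g) (cyclic_gen h) H,
             h = (cis (2 * pi / 3))%:M,
             isomorphic H (finset.setX (Zp 6) (Zp 3)),
             R = ring_of_integers 3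
           & \tr g = 1]
  | 5%N => [/\ H = generated [set g; h],
             [/\ g ^+ 3 = -1, h ^+ 4 = -1 & h * g * h^-1 = g^-1],
             presented5 H /\ (H #= `I_24)%card,
             R = gaussian_integers
           & eigenvalues h (cis (3 * pi / 4)) (cis (- (pi / 4)))]
  | 6%N => [/\ H = generated [set g; h],
             [/\ g ^+ 3 = -1, h ^+ 6 = 1 & h * g * h^-1 = g^-1],
             presented6 H /\ (H #= `I_36)%card,
             R = ring_of_integers 3
           & eigenvalues h (cis (2 * pi / 3)) (cis (- (pi / 3)))]
  | 7%N => [/\ is_dprod (cyclic_gen g) (cyclic_gen h) H,
             isomorphic H (finset.setX (Zp 6) (Zp 6)) /\ (H #= `I_36)%card,
             R = ring_of_integers 3
           & eigenvalues h (cis (2 * pi / 3)) (cis (- (pi / 3)))]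
  | _ => False
  end.

End Corollary.

(* Main.v *)
Require Import Defs.
From HB Require Import structures.
From mathcomp Require Import all_boot all_order all_fingroup all_algebra.
From mathcomp Require Import all_solvable.
From mathcomp Require Import complex.
From mathcomp Require Import boolp classical_sets functions cardinality.
From mathcomp Require Import reals trigo.
From mathcomp Require Import zify ring lra.

Set Implicit Arguments.
Unset Strict Implicit.
Unset Printing Implicit Defensive.

Import Order.TTheory GRing.Theory Num.Theory.

Local Open Scope ring_scope.
Local Open Scope complex_scope.
Local Open Scope classical_set_scope.

(** Why the theorem holds.

    Write zeta = exp (pi i / 3).  Since [g] lies in SL(2) and has order 6, its
    trace is 1 ([order6_trace]), so g^2 = g - 1, and conjugation by an element of
    [H] either fixes or inverts [g] ([normalizes_cases]).  If det(h) generates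
    det(H), every element of [H] is g^i h^j; hence [H] is the extension of
    <det(h)> by <g> recorded in [cyclic_extension], whose order, presentation and
    splitting can be read off from the normal form g^i h^j.

    The ring [R] enters only through the fact that each of its elements a has an
    integral trace 2 Re a and an integral norm |a|^2 ([elliptic_End_is_order]).
    So a unit other than 1 has, up to inversion, one of the four values
    -1, i, zeta, zeta^2 ([unit_or_inv_normalized]), and [R] is determined as soon
    as it contains i or zeta, and up to two choices as soon as it contains
    sqrt(-3) ([gaussian_of_i], [eisenstein_of_zeta6], [order_of_theta]).

    If h inverts g, then tr(h) = 0, and Cayley-Hamilton gives h^2 = - det(h).
    The values -1, i, zeta of det(h) give the groups 3, 5, 6; the value zeta^2
    would make h^3 both a multiple of h and a power of g, which is absurd
    ([classify_inverting]).

    If h commutes with g, both are diagonal in one basis, g with the eigenvalues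
    zeta and zeta^-1, h with some l1 and l2 on the unit circle; the traces
    l1 + l2 of h and zeta l1 + zeta^-1 l2 of gh lie in [R].
    - For det(h) = -1, h^2 is a power of g; after multiplying h by a power of g,
      either h = diag(1, -1) up to sign, and then gh has trace +-sqrt(-3)
      (group 2), or h^2 = g with h of trace i (group 1).
    - For det(h) = zeta or zeta^2, sqrt(-3) l1 is an Eisenstein integer of norm 3,
      so l1 is a sixth root of unity, and diag(1, det(h)) lies in [H]
      (groups 7 and 4).
    - For det(h) = i, the traces of h and gh are a(1+i) and b(1+i) with integers
      a, b, and a sum of three squared norms gives a^2 + b^2 + (b-a)^2 = 3, which
      is impossible modulo 2 ([no_commuting_imaginary]).

    The existence statements use a companion matrix (group 1), diagonal matrices
    (groups 2 and 7), scalar matrices (group 4), and, for the groups that invert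
    g, the matrix c [[0,1],[1,0]] with a suitable square root c of - det(h). *)

Local Notation Re := complex.Re.
Local Notation Im := complex.Im.

(** * Finite groups of units *)

Section FiniteUnitGroup.
Context {A : unitRingType} (s : seq A).

(** Indexed by the proof of closedness so that the group operations are total
    on the type of elements of the list. *)
Definition unit_group of is_subgroup [set` s] := seq_sub s.

Variable hs : is_subgroup [set` s].
Local Notation T := (unit_group hs).

HB.instance Definition _ := Finite.copy T (seq_sub s).

Fact unit_group_mul_subproof (x y : T) : ssval x * ssval y \in s.
Proof. by case: hs => _ _ + _; apply; exact: ssvalP. Qed.
Fact unit_group_inv_subproof (x : T) : (ssval x)^-1 \in s.
Proof. by case: hs => _ _ _; apply; exact: ssvalP. Qed.
Fact unit_group_one_subproof : 1 \in s.
Proof. by case: hs. Qed.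

Definition unit_group_mul (x y : T) : T := SeqSub (unit_group_mul_subproof x y).
Definition unit_group_inv (x : T) : T := SeqSub (unit_group_inv_subproof x).
Definition unit_group_one : T := SeqSub unit_group_one_subproof.

Fact unit_group_mulA : associative unit_group_mul.
Proof. by move=> x y z; apply: val_inj; rewrite /= mulrA. Qed.
Fact unit_group_mul1 : left_id unit_group_one unit_group_mul.
Proof. by move=> x; apply: val_inj; rewrite /= mul1r. Qed.
Fact unit_group_mulV : left_inverse unit_group_one unit_group_inv unit_group_mul.
Proof.
move=> x; apply: val_inj => /=; apply: mulVr.
by case: hs => + _ _ _; apply; exact: ssvalP.
Qed.

HB.instance Definition _ :=
  Finite_isGroup.Build T unit_group_mulA unit_group_mul1 unit_group_mulV.

End FiniteUnitGroup.

Lemma finite_subgroup_model (A : unitRingType) (H : set A) :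
  is_subgroup H -> finite_set H ->
  exists (gT : finGroupType) (f : gT -> A),
    [/\ injective f, {morph f : a b / (a * b)%g >-> a * b}
      & range f = H].
Proof.
move=> Hs /finite_seqP[s HE]; rewrite HE in Hs *.
exists (unit_group Hs), (@ssval _ s); split.
- exact: val_inj.
- by move=> a b.
- apply/seteqP; split=> [x [a _ <-]|x xs]; first exact: ssvalP.
  by exists (SeqSub xs).
Qed.

Section Powers.
Context {A : unitRingType}.
Implicit Types x g h : A.

Lemma torsion_unit x n : (0 < n)%N -> x ^+ n = 1 -> x \is a GRing.unit.
Proof.
case: n => // n _ xn; apply/unitrP; exists (x ^+ n).
by rewrite -exprS -exprSr xn.
Qed.

Lemma cyclic_gen_torsion x n : (0 < n)%N -> x ^+ n = 1 ->
  cyclic_gen x = [set x ^+ i | i in [set: nat]].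
Proof.
move=> n0 xn; apply/seteqP; split=> [_ [i _ <-]|_ [i _ <-]]; last by exists i%:Z.
case: i => i; first by exists i.
exists (n.-1 * i.+1)%N => //=.
rewrite NegzE -exprnN; have xU := torsion_unit n0 xn.
apply: (mulIr (unitrX i.+1 xU)); rewrite mulVr ?unitrX //.
rewrite -exprD -[X in (_ + X)%N]mul1n -mulnDl addn1 prednK //.
by rewrite exprM xn expr1n.
Qed.

Lemma cyclic_genX x i : cyclic_gen x (x ^+ i). Proof. by exists i%:Z. Qed.

Lemma has_order_inj x n i j : has_order x n -> (i < n)%N -> (j < n)%N ->
  x ^+ i = x ^+ j -> i = j.
Proof.
move=> [n0 xn xm]; wlog ij : i j / (i <= j)%N => [W|] i_n j_n E.
  by case: (leqP i j) => [|/ltnW] ij; [exact: W|symmetry; exact: W].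
move: ij; rewrite leq_eqVlt => /predU1P[//|ij].
have /eqP[] : x ^+ (j - i) != 1 by apply: xm; rewrite subn_gt0 ij; lia.
have xU := torsion_unit n0 xn.
apply: (mulrI (unitrX i xU)).
by rewrite -exprD subnKC ?mulr1 // ltnW.
Qed.

Lemma expr_has_order x n i : has_order x n -> x ^+ i = 1 -> (n %| i)%N.
Proof.
move=> xo; case: (xo) => n0 xn _ xi; rewrite /dvdn; apply/eqP.
apply: (has_order_inj xo); rewrite ?ltn_pmod //.
by rewrite expr0 -xi {2}(divn_eq i n) exprD mulnC exprM xn expr1n mul1r.
Qed.

Lemma has_orderI x n : (0 < n)%N -> x ^+ n = 1 ->
  (forall m, x ^+ m = 1 -> (n %| m)%N) -> has_order x n.
Proof.
move=> n0 xn xm; split=> // m /andP[m0 mn]; apply/eqP => /xm.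
by apply/negP; rewrite gtnNdvd.
Qed.

End Powers.

(** * Groups generated by a cyclic normal subgroup and one more element *)

Lemma generated_sub (A : unitRingType) (S M : set A) :
  is_subgroup M -> S `<=` M -> Defs.generated S `<=` M.
Proof. by move=> Ms SM x; apply. Qed.

(** <g> is normal of order [n], and [k] is exactly the order of [h] modulo
    <g>; [e] records the conjugation action of [h] on <g>. *)
Definition cyclic_extension (A : unitRingType) (n k e : nat) (g h : A) : Prop :=
  [/\ has_order g n, h * g = g ^+ e * h, (0 < k)%N, cyclic_gen g (h ^+ k)
    & forall j, cyclic_gen g (h ^+ j) -> (k %| j)%N].

Section Metacyclic.
Context {A : unitRingType} (g h : A) (n k e : nat).
Hypothesis ext : cyclic_extension n k e g h.

Let og : has_order g n. Proof. by case: ext. Qed.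
Let hg : h * g = g ^+ e * h. Proof. by case: ext. Qed.
Let k_gt0 : (0 < k)%N. Proof. by case: ext. Qed.
Let hk : cyclic_gen g (h ^+ k). Proof. by case: ext. Qed.
Let k_min : forall j, cyclic_gen g (h ^+ j) -> (k %| j)%N.
Proof. by case: ext. Qed.
Let n_gt0 : (0 < n)%N. Proof. by case: og. Qed.
Let gn : g ^+ n = 1. Proof. by case: og. Qed.
Let gU : g \is a GRing.unit. Proof. exact: torsion_unit gn. Qed.

(** Some power of [h] falls into the finite cyclic group <g>. *)
Lemma metacyclic_h_torsion : exists2 N, (0 < N)%N & h ^+ N = 1.
Proof.
have [i _ hki] : [set g ^+ i | i in [set: nat]] (h ^+ k).
  by rewrite -(cyclic_gen_torsion n_gt0 gn).
exists (k * n)%N; first by rewrite muln_gt0 k_gt0.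
by rewrite exprM -hki -exprM mulnC exprM gn expr1n.
Qed.

Lemma metacyclic_h_unit : h \is a GRing.unit.
Proof. by have [N N0 hN] := metacyclic_h_torsion; exact: torsion_unit hN. Qed.
Let hU := metacyclic_h_unit.

Lemma metacyclic_swap i j : h ^+ j * g ^+ i = g ^+ (e ^ j * i) * h ^+ j.
Proof.
have swap1 : forall m, h * g ^+ m = g ^+ (e * m) * h.
  elim=> [|m IH]; first by rewrite muln0 !expr0 mulr1 mul1r.
  by rewrite exprSr mulrA IH -mulrA hg mulrA -exprD mulnS addnC.
elim: j i => [|j IH] i; first by rewrite expn0 mul1n !expr0 mulr1 mul1r.
by rewrite exprSr -mulrA swap1 mulrA IH -!mulrA -exprSr expnSr mulnA.
Qed.

Lemma metacyclic_subgroup :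
  is_subgroup [set g ^+ i * h ^+ j | i in [set: nat] & j in [set: nat]].
Proof.
have [N N0 hN] := metacyclic_h_torsion.
have Mmul i j i' j' : exists a b,
    (g ^+ i * h ^+ j) * (g ^+ i' * h ^+ j') = g ^+ a * h ^+ b.
  exists (i + e ^ j * i')%N, (j + j')%N.
  by rewrite -mulrA (mulrA (h ^+ j)) metacyclic_swap !exprD !mulrA.
split.
- by move=> _ [i _ [j _ <-]]; rewrite unitrMl ?unitrX.
- by exists 0%N => //; exists 0%N => //; rewrite !expr0 mulr1.
- move=> _ _ [i _ [j _ <-]] [i' _ [j' _ <-]].
  by have [a [b ->]] := Mmul i j i' j'; exists a => //; exists b.
- move=> _ [i _ [j _ <-]].
  have -> : (g ^+ i * h ^+ j)^-1
          = (g ^+ 0 * h ^+ (N.-1 * j)) * (g ^+ (n.-1 * i) * h ^+ 0).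
    rewrite invrM ?unitrX // !expr0 mulr1 mul1r; congr (_ * _).
      apply: (mulIr (unitrX j hU)); rewrite mulVr ?unitrX // -exprD.
      by rewrite -[X in (_ + X)%N]mul1n -mulnDl addn1 prednK // exprM hN expr1n.
    apply: (mulIr (unitrX i gU)); rewrite mulVr ?unitrX // -exprD.
    by rewrite -[X in (_ + X)%N]mul1n -mulnDl addn1 prednK // exprM gn expr1n.
  by have [a [b ->]] := Mmul 0%N (N.-1 * j)%N (n.-1 * i)%N 0%N; exists a => //; exists b.
Qed.

Lemma metacyclic_generated :
  Defs.generated [set g; h] =
  [set g ^+ i * h ^+ j | i in [set: nat] & j in [set: nat]].
Proof.
apply/seteqP; split.
  apply: generated_sub; first exact: metacyclic_subgroup.
  move=> x [->|->].
    by exists 1%N => //; exists 0%N => //; rewrite expr0 mulr1.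
  by exists 0%N => //; exists 1%N => //; rewrite expr0 mul1r.
move=> _ [i _ [j _ <-]] M [[_ M1 MM _] SM].
have MX x m : M x -> M (x ^+ m).
  by move=> Mx; elim: m => // m IH; rewrite exprS; exact: MM.
by apply: MM; apply: MX; apply: SM; [left|right].
Qed.

Lemma metacyclic_normal_form x : Defs.generated [set g; h] x ->
  exists i j, [/\ (i < n)%N, (j < k)%N & x = g ^+ i * h ^+ j].
Proof.
rewrite metacyclic_generated => -[i _ [j _ <-]].
have [c _ hkc] : [set g ^+ i | i in [set: nat]] (h ^+ k).
  by rewrite -(cyclic_gen_torsion n_gt0 gn).
exists ((i + c * (j %/ k)) %% n)%N, (j %% k)%N; rewrite !ltn_pmod //; split=> //.
rewrite (expr_mod _ gn) exprD -mulrA; congr (_ * _).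
by rewrite {1}(divn_eq j k) exprD mulnC exprM -hkc -exprM.
Qed.

(** Comparing two normal forms with j <= j' puts h^(j'-j) into <g>, so k
    divides j' - j < k. *)
Lemma metacyclic_normal_form_inj i j i' j' : (i < n)%N -> (i' < n)%N ->
  (j < k)%N -> (j' < k)%N -> g ^+ i * h ^+ j = g ^+ i' * h ^+ j' ->
  i = i' /\ j = j'.
Proof.
move=> in_ i'n jk j'k.
wlog jj : i j i' j' in_ i'n jk j'k / (j <= j')%N => [W|] E.
  case: (leqP j j') => [jj|/ltnW jj]; first exact: W.
  by have [||||||-> ->] := W i' j' i j.
suff jE : j = j'.
  split=> //; apply: (has_order_inj og) => //.
  by move: E; rewrite jE; apply: (mulIr (unitrX j' hU)).
have E' : h ^+ (j' - j) = g ^+ (n - i') * g ^+ i.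
  apply: (mulIr (unitrX j hU)); rewrite -exprD subnK // -mulrA E mulrA -exprD.
  by rewrite subnK ?gn ?mul1r // ltnW.
have /k_min : cyclic_gen g (h ^+ (j' - j)).
  by rewrite E' -exprD; exact: cyclic_genX.
case: (posnP (j' - j)%N) => [|p /(dvdn_leq p)]; lia.
Qed.

Lemma metacyclic_finite : finite_set (Defs.generated [set g; h]).
Proof.
apply: (@sub_finite_set _ _
  [set x | x \in [seq g ^+ i * h ^+ j | i <- iota 0 n, j <- iota 0 k]]).
  move=> x /metacyclic_normal_form[i [j [i_n j_k ->]]] /=.
  by apply/allpairsP; exists (i, j); rewrite !mem_iota.
exact: finite_seq.
Qed.

(** Carries the extension over to finite group theory, where the presentations
    live. *)
Lemma metacyclic_model :
  exists (gT : finGroupType) (G : {group gT}) (f : gT -> A) (a b : gT),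
    [/\ isomorphic (Defs.generated [set g; h]) G, injective f,
        {morph f : u v / (u * v)%g >-> u * v},
        [/\ f a = g, f b = h & f 1%g = 1]
      & G = <<[set a; b]%SET>>%g :> {set gT} /\ #|G| = (n * k)%N].
Proof.
have Msub : is_subgroup (Defs.generated [set g; h]).
  by rewrite metacyclic_generated; exact: metacyclic_subgroup.
have [gT [f [finj fM fR]]] := finite_subgroup_model Msub metacyclic_finite.
have Mg : Defs.generated [set g; h] g by move=> M [_ SM]; apply: SM; left.
have Mh : Defs.generated [set g; h] h by move=> M [_ SM]; apply: SM; right.
have [a _ fa] : range f g by rewrite fR.
have [b _ fb] : range f h by rewrite fR.
have f1 : f 1%g = 1.
  have fU : f 1%g \is a GRing.unit.
    by case: Msub => + _ _ _; apply; rewrite -fR; exists 1%g.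
  by apply: (mulrI fU); rewrite -fM mulg1 mulr1.
have fX u m : f (u ^+ m)%g = f u ^+ m.
  by elim: m => [|m IH]; rewrite ?expr0 ?expg0 // expgS exprS fM IH.
exists gT, [set: gT]%G, f, a, b; split=> //; first 1 last.
- split.
    apply/eqP; rewrite finset.eqEsubset finset.subsetT andbT; apply/fintype.subsetP=> u _.
    have /metacyclic_normal_form[i [j [_ _ uE]]] : Defs.generated [set g; h] (f u).
      by rewrite -fR; exists u.
    have -> : u = (a ^+ i * b ^+ j)%g.
      by apply: finj; rewrite fM !fX fa fb.
    by rewrite groupM // groupX // mem_gen // !inE eqxx ?orbT.
  pose F (p : 'I_n * 'I_k) : gT := (a ^+ p.1 * b ^+ p.2)%g.
  have Finj : injective F.
    move=> [i j] [i' j'] /(congr1 f); rewrite /F !fM !fX fa fb /=.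
    move/(metacyclic_normal_form_inj (ltn_ord i) (ltn_ord i') (ltn_ord j) (ltn_ord j')).
    by case=> /val_inj-> /val_inj->.
  have FT : [set: gT]%SET = (F @: [set: 'I_n * 'I_k]%SET)%SET.
    apply/esym/eqP; rewrite finset.eqEsubset finset.subsetT /=; apply/fintype.subsetP=> u _.
    have /metacyclic_normal_form[i [j [i_n j_k uE]]] : Defs.generated [set g; h] (f u).
      by rewrite -fR; exists u.
    apply/imsetP; exists (Ordinal i_n, Ordinal j_k); first by rewrite inE.
    by apply: finj; rewrite /F fM !fX fa fb.
  by rewrite [LHS](_ : _ = #|(F @: [set: 'I_n * 'I_k]%SET)%SET|) -?FT // FT card_imset // cardsT card_prod !card_ord.
- exists f; split=> //; first by move=> u v _ _; exact: finj.
  by rewrite -fR; congr image; apply/seteqP; split=> // u _; rewrite /= inE.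
Qed.

End Metacyclic.

(** * The presentations *)

Section MetacyclicPresentation.
Local Open Scope group_scope.
Variables (n k e c : nat).
Hypotheses (n_gt0 : (0 < n)%N) (k_gt0 : (0 < k)%N).

(** Conjugation is written y x = x^e y, the form in which it transfers from
    the matrices. *)
Definition metacyclic_rel (gT : finGroupType) (x y : gT) :=
  [/\ x ^+ n = 1, y * x = x ^+ e * y & y ^+ k = x ^+ c].

(** The group is the product of <x> and <y>, whose intersection contains y^k.
    *)
Lemma metacyclic_rel_card (gT : finGroupType) (x y : gT) :
  metacyclic_rel x y -> (#|<<[set x; y]%SET>>| <= n * k)%N.
Proof.
move=> [xn yx yk].
have nyx : y \in 'N(<[x]>).
  rewrite -groupV; rewrite inE -cycleJ cycle_subG.
  have -> : x ^ y^-1 = x ^+ e by rewrite conjgE invgK mulgA yx mulgK.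
  exact: mem_cycle.
have -> : <<[set x; y]%SET>> = <[x]> * <[y]>.
  by rewrite -norm_joinEr ?cycle_subG // joing_idl joing_idr.
have := mul_cardG <[x]> <[y]>; rewrite -!orderE => E.
have x_le : (#[x] <= n)%N by apply: dvdn_leq => //; rewrite order_dvdn xn.
have y_le : (#[y] <= k * #|<[x]> :&: <[y]>|)%N.
  apply: (@leq_trans (k * #[y ^+ k])).
    apply: dvdn_leq; first by rewrite muln_gt0 k_gt0 order_gt0.
    by rewrite order_dvdn expgM expg_order.
  rewrite leq_mul2l orderE subset_leq_card ?orbT // cycle_subG finset.inE.
  by rewrite mem_cycle yk mem_cycle.
have cap_gt0 : (0 < #|<[x]> :&: <[y]>|)%N by exact: cardG_gt0.
rewrite -(leq_pmul2r cap_gt0) -E -mulnA.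
exact: leq_mul.
Qed.

(** The relations also hold for the pairs (x, x') and (y, y'), so the subgroup
    of the direct product generated by these pairs has at most n k elements.
    Its first projection is onto a group with exactly n k elements, hence an
    isomorphism; its second projection is then the required map. *)
Lemma metacyclic_rel_homg (gT rT : finGroupType) (x y : gT) (x' y' : rT) :
  metacyclic_rel x y -> metacyclic_rel x' y' ->
  #|<<[set x; y]%SET>>| = (n * k)%N ->
  <<[set x'; y']%SET>> \homg <<[set x; y]%SET>>.
Proof.
move=> [xn yx yk] [xn' yx' yk'] cG.
pose S : {set gT * rT} := [set (x, x'); (y, y')]%SET.
pose D := <<S>>%G.
have pairX (u : gT) (v : rT) m : (u, v) ^+ m = (u ^+ m, v ^+ m).
  by elim: m => [|m IH]; rewrite ?expg0 // !expgS IH.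
have cD : (#|D| <= n * k)%N.
  apply: metacyclic_rel_card; split.
  - by rewrite pairX xn xn'.
  - by rewrite pairX -![LHS]/(_, _) -![RHS]/(_, _) yx yx'.
  - by rewrite !pairX yk yk'.
have D1 : (@fst gT rT @* D)%g = <<[set x; y]%SET>>.
  by rewrite morphim_gen ?finset.subsetT // morphimEsub ?finset.subsetT //
     imsetU1 imset_set1.
have D2 : (@snd gT rT @* D)%g = <<[set x'; y']%SET>>.
  by rewrite morphim_gen ?finset.subsetT // morphimEsub ?finset.subsetT //
     imsetU1 imset_set1.
have injD : 'injm (restrm (finset.subsetT D) (@fst gT rT)).
  rewrite -card_im_injm.
  have -> : (restrm (finset.subsetT D) (@fst gT rT) @* D)%g = <<[set x; y]%SET>>.
    by rewrite morphim_restrm finset.setIid.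
  rewrite eqn_leq cG cD andbT -cG -D1.
  exact: leq_morphim.
have isoD : D \isog <<[set x; y]%SET>>.
  apply/isogP; exists (restrm (finset.subsetT D) (@fst gT rT))%R => //.
  by rewrite morphim_restrm finset.setIid.
apply: homg_trans (isog_hom isoD).
by rewrite -D2; exact: morphim_homg (finset.subsetT D).
Qed.

End MetacyclicPresentation.

Section SixthOrder.
Local Open Scope group_scope.

Lemma inv_expg5 (gT : finGroupType) (x : gT) : x ^+ 6 = 1 -> x^-1 = x ^+ 5.
Proof. by move=> x6; apply: (mulgI x); rewrite mulgV -expgS x6. Qed.

(** Passes between the inverted generator of the presentations and the
    exponent 5 of [metacyclic_rel]. *)
Lemma conj_expg5 (gT : finGroupType) (x y : gT) : x ^+ 6 = 1 ->
  (y * x * y^-1 == x^-1) = (y * x == x ^+ 5 * y).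
Proof.
move=> x6; rewrite (inv_expg5 x6); apply/eqP/eqP => [<-|->].
  by rewrite mulgKV.
by rewrite mulgK.
Qed.

Lemma joing_cube (gT : finGroupType) (x y : gT) :
  <[x]> <*> <[y]> <*> <[x ^+ 3]> = <<[set x; y]%SET>>.
Proof.
have -> : <[x]> <*> <[y]> = <<[set x; y]%SET>>.
  by rewrite joing_idl joing_idr.
rewrite /= joingC; apply/joing_idPr.
by rewrite cycle_subG groupX // mem_gen // !finset.inE eqxx.
Qed.

(** The letter z of the presentations stands for x^3, which is central because
    15 = 3 modulo 6. *)
Lemma cube_central (gT : finGroupType) (x y : gT) k c :
  metacyclic_rel 6 k 5 c x y -> [~ x ^+ 3, x] = 1 /\ [~ x ^+ 3, y] = 1.
Proof.
move=> [x6 yx _]; split; apply/eqP/commgP; first exact/commute_sym/commuteX.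
rewrite /commute.
have -> : y * x ^+ 3 = x ^+ 15 * y.
  have step m : y * x ^+ m = x ^+ (5 * m) * y.
    elim: m => [|m IH]; first by rewrite muln0 mulg1 mul1g.
    by rewrite expgSr mulgA IH -mulgA yx mulgA -expgD mulnSr.
  exact: step.
by rewrite (_ : x ^+ 15 = x ^+ 3) // -(expg_mod _ x6).
Qed.

Lemma Grp_dihedral12 (gT : finGroupType) (G : {group gT}) (x y : gT) :
  G = <<[set x; y]%SET>> :> {set gT} -> #|G| = (6 * 2)%N ->
  metacyclic_rel 6 2 5 0 x y ->
  (G \isog Grp (x : y : z : (z ^+ 2, [~ z, x], [~ z, y],
                               x ^+ 3 = z, y ^+ 2, y * x * y^-1 = x^-1))).
Proof.
move=> GE cG rxy; case: (rxy) => x6 yx yk; apply: intro_isoGrp.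
  apply/existsP; exists (x, y, x ^+ 3); rewrite /= !xpair_eqE.
  have [-> ->] := cube_central rxy.
  by rewrite joing_cube GE -expgM x6 yk conj_expg5 // yx !eqxx.
move=> rT H /existsP[[[x' y'] z']] /=; rewrite !xpair_eqE.
case/and5P=> /eqP<- /eqP z2 _ _ /and3P[/eqP x3 y2 yx'].
rewrite -{z'}x3 in z2 y2 *.
have x6' : x' ^+ 6 = 1 by rewrite (expgM x' 3 2).
rewrite joing_cube GE; apply: metacyclic_rel_homg rxy _ _ => //; last first.
  by rewrite -cG GE.
by split=> //; apply/eqP; rewrite -?conj_expg5.
Qed.

Lemma Grp_order24 (gT : finGroupType) (G : {group gT}) (x y : gT) :
  G = <<[set x; y]%SET>> :> {set gT} -> #|G| = (6 * 4)%N ->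
  metacyclic_rel 6 4 5 3 x y ->
  (G \isog Grp (x : y : z : (z ^+ 2, [~ z, x], [~ z, y],
                               x ^+ 3 = y ^+ 4 = z, y * x * y^-1 = x^-1))).
Proof.
move=> GE cG rxy; case: (rxy) => x6 yx yk; apply: intro_isoGrp.
  apply/existsP; exists (x, y, x ^+ 3); rewrite /= !xpair_eqE.
  have [-> ->] := cube_central rxy.
  by rewrite joing_cube GE -expgM x6 yk conj_expg5 // yx !eqxx.
move=> rT H /existsP[[[x' y'] z']] /=; rewrite !xpair_eqE.
case/and5P=> /eqP<- /eqP z2 _ _ /and3P[/eqP x3 y4 yx'].
rewrite -{z'}x3 in z2 y4 *.
have x6' : x' ^+ 6 = 1 by rewrite (expgM x' 3 2).
rewrite joing_cube GE; apply: metacyclic_rel_homg rxy _ _ => //; last first.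
  by rewrite -cG GE.
by split=> //; apply/eqP; rewrite -?conj_expg5.
Qed.

Lemma Grp_order36 (gT : finGroupType) (G : {group gT}) (x y : gT) :
  G = <<[set x; y]%SET>> :> {set gT} -> #|G| = (6 * 6)%N ->
  metacyclic_rel 6 6 5 0 x y ->
  (G \isog Grp (x : y : z : (z ^+ 2, [~ z, x], [~ z, y],
                               x ^+ 3 = z, y ^+ 6, y * x * y^-1 = x^-1))).
Proof.
move=> GE cG rxy; case: (rxy) => x6 yx yk; apply: intro_isoGrp.
  apply/existsP; exists (x, y, x ^+ 3); rewrite /= !xpair_eqE.
  have [-> ->] := cube_central rxy.
  by rewrite joing_cube GE -expgM x6 yk conj_expg5 // yx !eqxx.
move=> rT H /existsP[[[x' y'] z']] /=; rewrite !xpair_eqE.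
case/and5P=> /eqP<- /eqP z2 _ _ /and3P[/eqP x3 y6 yx'].
rewrite -{z'}x3 in z2 y6 *.
have x6' : x' ^+ 6 = 1 by rewrite (expgM x' 3 2).
rewrite joing_cube GE; apply: metacyclic_rel_homg rxy _ _ => //; last first.
  by rewrite -cG GE.
by split=> //; apply/eqP; rewrite -?conj_expg5.
Qed.

Lemma isog_dihedral12 (gT : finGroupType) (G : {group gT}) (x y : gT) :
  G = <<[set x; y]%SET>> :> {set gT} -> #|G| = 12%N ->
  metacyclic_rel 6 2 5 0 x y -> 'D_12 \isog G.
Proof.
move=> GE cG [x6 yx y2]; rewrite isog_sym.
apply/(isoGrpP _ (@Grp_dihedral 6 isT)); rewrite card_dihedral //; split=> //.
apply/existsP; exists (x, y); rewrite /= !xpair_eqE joing_idl joing_idr GE x6 y2.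
rewrite !eqxx /= conjgE (_ : y^-1 = y); last first.
  by apply: (mulgI y); rewrite mulgV -[RHS]/(y ^+ 2) y2.
rewrite mulgA yx -mulgA -[X in _ * X]/(y ^+ 2) y2 mulg1.
by rewrite (inv_expg5 x6).
Qed.

End SixthOrder.

(** * Isomorphism types *)

Section CyclicGroups.
Context {A : unitRingType}.
Implicit Types (x g h : A).

Lemma Zp_mulE n (a b : 'Z_n) : (1 < n)%N ->
  ((a * b)%g : nat) = ((a + b) %% n)%N.
Proof. by move=> n1; rewrite -[X in (_ %% X)%N]Zp_cast. Qed.

Lemma Zp_lt n (a : 'Z_n) : (1 < n)%N -> (a < n)%N.
Proof. by move=> n1; rewrite -[X in (_ < X)%N]Zp_cast. Qed.

Lemma in_Zp n (a : 'Z_n) : (1 < n)%N -> a \in Zp n.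
Proof. by move=> n1; rewrite /Zp n1 finset.inE. Qed.

Lemma has_order_isomorphic x n : (1 < n)%N -> has_order x n ->
  isomorphic (cyclic_gen x) (Zp n).
Proof.
move=> n1 ox; case: (ox) => n0 xn _; exists (fun a : 'Z_n => x ^+ a); split.
- move=> a b _ _ E; apply: val_inj.
  by apply: (has_order_inj ox _ _ E); exact: Zp_lt.
- by move=> a b _ _; rewrite Zp_mulE // expr_mod // exprD.
- rewrite (cyclic_gen_torsion n0 xn); apply/seteqP; split.
    by move=> _ [a _ <-]; exists a.
  move=> _ [i _ <-]; exists (inZp i : 'Z_n); first exact: in_Zp.
  rewrite -(expr_mod i xn); congr (x ^+ _).
  by rewrite -[in RHS](Zp_cast n1).
Qed.

(** The image of a generator of Z/n is a power of [x], so an exponent that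
    kills [x] kills the generator as well. *)
Lemma isomorphic_has_order x n : (1 < n)%N ->
  isomorphic (cyclic_gen x) (Zp n) -> has_order x n.
Proof.
move=> n1 [f [finj fM fR]].
have [a aZ fa] : (f @` [set` Zp n]) x by rewrite fR; exact: (@cyclic_genX _ x 1).
have [b bZ fb] : (f @` [set` Zp n]) 1 by rewrite fR; exact: (@cyclic_genX _ x 0).
have Z1 : (1 : 'Z_n)%g \in Zp n by exact: in_Zp.
have f1 : f 1%g = 1.
  by rewrite -[LHS]mulr1 -fb -fM ?mul1g.
have fX m : f (a ^+ m)%g = x ^+ m.
  elim: m => [|m IH]; first by rewrite expg0 expr0.
  by rewrite expgS exprS fM ?in_Zp // fa IH.
have n0 := ltnW n1.
have aZn m (c : 'Z_n) : (n %| m)%N -> (c ^+ m = 1)%g.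
  move=> nm; apply/eqP; rewrite -order_dvdn (dvdn_trans _ nm) //.
  have := order_dvdG (G := Zp_group n) (in_Zp c n1).
  by rewrite card_Zp.
have xn : x ^+ n = 1 by rewrite -fX (aZn n) ?dvdnn.
apply: has_orderI => // m xm.
have am : (a ^+ m = 1)%g by apply: finj; rewrite ?in_Zp // fX f1.
have : cyclic_gen x (f Zp1) by rewrite -fR; exists Zp1 => //; exact: in_Zp.
rewrite (cyclic_gen_torsion n0 xn) => -[i _]; rewrite -fX => /finj E.
have {}E : (a ^+ i)%g = Zp1 by apply: E; exact: in_Zp.
have : (Zp1 ^+ m = 1 :> 'Z_n)%g by rewrite -E expgAC am expg1n.
move/eqP; rewrite -order_dvdn order_Zp1.
by rewrite Zp_cast.
Qed.

Lemma has_order_expr1 x n : (1 < n)%N -> has_order x n -> x != 1.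
Proof. by move=> n1 [_ _ /(_ 1%N)]; rewrite n1 expr1; apply. Qed.

End CyclicGroups.

Section MetacyclicTypes.
Context {A : unitRingType} (g h : A).

Lemma metacyclic_card n k e : cyclic_extension n k e g h ->
  (Defs.generated [set g; h] #= `I_(n * k))%card.
Proof.
move=> ext.
pose F (m : nat) := g ^+ (m %/ k) * h ^+ (m %% k).
have k0 : (0 < k)%N by case: ext.
rewrite (_ : Defs.generated [set g; h] = F @` `I_(n * k)).
  apply: inj_card_eq => m m'; rewrite !inE /= => mn mn'.
  move/(metacyclic_normal_form_inj ext); rewrite !ltn_divLR // !ltn_pmod //.
  by case=> // E1 E2; rewrite (divn_eq m k) E1 E2 -divn_eq.
apply/seteqP; split=> [x|_ [m _ <-]]; last first.
  by rewrite (metacyclic_generated ext); exists (m %/ k)%N => //; exists (m %% k)%N.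
move/(metacyclic_normal_form ext) => [i [j [i_n j_k ->]]].
exists (i * k + j)%N; rewrite /F /= ?divnMDl // ?modnMDl ?divn_small ?modn_small ?addn0 //.
by nia.
Qed.

Lemma metacyclic_rel_model k c : cyclic_extension 6 k 5 g h -> h ^+ k = g ^+ c ->
  exists (gT : finGroupType) (G : {group gT}) (a b : gT),
    [/\ isomorphic (Defs.generated [set g; h]) G,
        G = <<[set a; b]%SET>>%g :> {set gT}, #|G| = (6 * k)%N
      & metacyclic_rel 6 k 5 c a b].
Proof.
move=> ext hk; have [[_ g6 _] hg _ _ _] := ext.
have [gT [G [f [a [b [isoG finj fM [fa fb f1] [GE cG]]]]]]] := metacyclic_model ext.
exists gT, G, a, b; split=> //.
have fX u m : f (u ^+ m)%g = f u ^+ m.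
  by elim: m => [|m IH]; rewrite ?expr0 ?expg0 // expgS exprS fM IH.
by split; apply: finj; rewrite ?fM ?fX ?fa ?fb ?f1.
Qed.

Lemma metacyclic_presented3 : cyclic_extension 6 2 5 g h -> h ^+ 2 = 1 ->
  presented3 (Defs.generated [set g; h]).
Proof.
move=> ext h2; have [|gT [G [a [b [isoG GE cG rel]]]]] := metacyclic_rel_model (c := 0) ext.
  by rewrite h2.
by exists gT, G; split=> //; exact: Grp_dihedral12 rel.
Qed.

Lemma metacyclic_presented5 : cyclic_extension 6 4 5 g h -> h ^+ 4 = g ^+ 3 ->
  presented5 (Defs.generated [set g; h]).
Proof.
move=> ext h4; have [//|gT [G [a [b [isoG GE cG rel]]]]] := metacyclic_rel_model (c := 3) ext.
by exists gT, G; split=> //; exact: Grp_order24 rel.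
Qed.

Lemma metacyclic_presented6 : cyclic_extension 6 6 5 g h -> h ^+ 6 = 1 ->
  presented6 (Defs.generated [set g; h]).
Proof.
move=> ext h6; have [|gT [G [a [b [isoG GE cG rel]]]]] := metacyclic_rel_model (c := 0) ext.
  by rewrite h6.
by exists gT, G; split=> //; exact: Grp_order36 rel.
Qed.

Lemma isomorphic_isog (H : set A) (gT rT : finGroupType) (G : {group gT})
    (K : {group rT}) : isomorphic H G -> K \isog G -> isomorphic H K.
Proof.
move=> [f [finj fM fR]] /isogP[p injp pK].
exists (f \o p); split.
- move=> a b aK bK /finj E; apply: (injmP injp) => //.
  by apply: E; rewrite -pK mem_morphim.
- by move=> a b aK bK; rewrite /= morphM // fM // -pK mem_morphim.
- rewrite -fR; apply/seteqP; split=> _ [a aK <-].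
    by exists (p a) => //; rewrite /= -pK mem_morphim.
  move: aK; rewrite /= -pK => /morphimP[c cK _ ->]; by exists c.
Qed.

Lemma metacyclic_dihedral : cyclic_extension 6 2 5 g h -> h ^+ 2 = 1 ->
  isomorphic (Defs.generated [set g; h]) ('D_12)%g.
Proof.
move=> ext h2; have [|gT [G [a [b [isoG GE cG rel]]]]] := metacyclic_rel_model (c := 0) ext.
  by rewrite h2.
exact: (isomorphic_isog (K := [group of 'D_12]%g) isoG (isog_dihedral12 GE cG rel)).
Qed.

Lemma metacyclic_dprod n k : cyclic_extension n k 1 g h -> h ^+ k = 1 ->
  is_dprod (cyclic_gen g) (cyclic_gen h) (Defs.generated [set g; h]).
Proof.
move=> ext hk; have [[n0 gn _] hg k0 _ kmin] := ext.
have swap := metacyclic_swap ext.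
rewrite (cyclic_gen_torsion n0 gn) (cyclic_gen_torsion k0 hk); split.
- rewrite (metacyclic_generated ext); apply/seteqP; split.
    by move=> _ [i _ [j _ <-]]; exists (g ^+ i); [exists i|exists (h ^+ j) => //; exists j].
  by move=> _ [_ [i _ <-] [_ [j _ <-] <-]]; exists i => //; exists j.
- apply/seteqP; split=> [x [[i _ <-] [j _ E]]|_ ->]; last first.
    by split; exists 0%N => //; rewrite expr0.
  have /kmin/dvdnP[q jE] : cyclic_gen g (h ^+ j) by rewrite E; exact: cyclic_genX.
  by rewrite /= -E jE mulnC exprM hk expr1n.
- by move=> _ _ [i _ <-] [j _ <-]; rewrite swap exp1n mul1n.
Qed.

(** With a trivial action the normal form is multiplicative in the two
    exponents. *)
Lemma metacyclic_dprod_isomorphic n k : (1 < n)%N -> (1 < k)%N ->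
  cyclic_extension n k 1 g h -> h ^+ k = 1 ->
  isomorphic (Defs.generated [set g; h]) (finset.setX (Zp n) (Zp k)).
Proof.
move=> n1 k1 ext hk; have [[_ gn _] _ _ _ _] := ext.
exists (fun p : 'Z_n * 'Z_k => g ^+ p.1 * h ^+ p.2); split.
- move=> [a b] [a' b'] _ _ /=.
  move/(metacyclic_normal_form_inj ext (Zp_lt a n1) (Zp_lt a' n1) (Zp_lt b k1) (Zp_lt b' k1)).
  by case=> /val_inj-> /val_inj->.
- move=> [a b] [a' b'] _ _.
  change (g ^+ (a * a')%g * h ^+ (b * b')%g =
          (g ^+ a * h ^+ b) * (g ^+ a' * h ^+ b')).
  rewrite !Zp_mulE // !expr_mod // !exprD.
  rewrite -!mulrA; congr (_ * _); rewrite !mulrA; congr (_ * _).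
  by rewrite (metacyclic_swap ext) exp1n mul1n.
- apply/seteqP; split=> [_ [[a b] _ <-]|x].
    by rewrite (metacyclic_generated ext); exists a => //; exists b.
  move/(metacyclic_normal_form ext) => [i [j [i_n j_k ->]]].
  rewrite -(Zp_cast n1) in i_n; rewrite -(Zp_cast k1) in j_k.
  exists (Ordinal i_n : 'Z_n, Ordinal j_k : 'Z_k) => //=.
  by rewrite finset.in_setX !in_Zp.
Qed.

End MetacyclicTypes.

(** * Two by two matrices *)

Section Matrix2.
Context {F : comNzRingType}.
Implicit Types (A B : 'M[F]_2).

Lemma ord2E (i : 'I_2) : i = 0 \/ i = 1.
Proof. by case: i => [[|[|//]] ?]; [left|right]; exact: val_inj. Qed.

Lemma mx2P A B : A 0 0 = B 0 0 -> A 0 1 = B 0 1 -> A 1 0 = B 1 0 ->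
  A 1 1 = B 1 1 -> A = B.
Proof.
move=> *; apply/matrixP => i j.
by case: (ord2E i) => ->; case: (ord2E j) => ->.
Qed.

Lemma sum2E (f : 'I_2 -> F) : \sum_i f i = f 0 + f 1.
Proof.
by rewrite !big_ord_recl big_ord0 addr0; congr (_ + f _); exact: val_inj.
Qed.

Lemma mul2E A B i j : (A * B) i j = A i 0 * B 0 j + A i 1 * B 1 j.
Proof. by rewrite !mxE sum2E. Qed.

Lemma tr2E A : \tr A = A 0 0 + A 1 1. Proof. exact: sum2E. Qed.

Lemma det2E A : \det A = A 0 0 * A 1 1 - A 0 1 * A 1 0.
Proof.
have l01 : lift 0 (0 : 'I_1) = 1 :> 'I_2 by exact: val_inj.
have l10 : lift 1 (0 : 'I_1) = 0 :> 'I_2 by exact: val_inj.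
rewrite (expand_det_row _ 0) sum2E /cofactor !det_mx11 !mxE.
by rewrite l01 l10 /= expr0 expr1 mul1r mulN1r mulrN.
Qed.

Lemma one2E : ((1 : 'M[F]_2) 0 0 = 1) * ((1 : 'M[F]_2) 0 1 = 0) *
  ((1 : 'M[F]_2) 1 0 = 0) * ((1 : 'M[F]_2) 1 1 = 1).
Proof. by rewrite !mxE. Qed.

Lemma scalar2E (a : F) : ((a%:M : 'M[F]_2) 0 0 = a) * ((a%:M : 'M[F]_2) 0 1 = 0) *
  ((a%:M : 'M[F]_2) 1 0 = 0) * ((a%:M : 'M[F]_2) 1 1 = a).
Proof. by rewrite !mxE. Qed.

Lemma opp2E A i j : (- A) i j = - A i j. Proof. by rewrite mxE. Qed.
Lemma add2E A B i j : (A + B) i j = A i j + B i j. Proof. by rewrite mxE. Qed.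
Lemma scale2E a A i j : (a *: A) i j = a * A i j. Proof. by rewrite mxE. Qed.

Definition mx2E :=
  (mul2E, tr2E, det2E, one2E, scalar2E, opp2E, add2E, scale2E).

End Matrix2.

Section Matrix2Field.
Context {F : fieldType}.
Implicit Types (A B g h : 'M[F]_2).

Lemma Cayley_Hamilton2 A : A ^+ 2 = \tr A *: A - (\det A)%:M.
Proof. by apply: mx2P; rewrite expr2 !mx2E; ring. Qed.

Lemma char_poly2 A : char_poly A = 'X^2 - (\tr A)%:P * 'X + (\det A)%:P.
Proof.
rewrite /char_poly det2E !mxE /= mulr1n mulr0n !sub0r tr2E det2E.
by rewrite polyCB !polyCM polyCD; ring.
Qed.

(** The trace and the determinant are all there is in a characteristic
    polynomial of degree 2. *)
Lemma eigenvalues2 A (l1 l2 : F) : \tr A = l1 + l2 -> \det A = l1 * l2 ->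
  char_poly A = ('X - l1%:P) * ('X - l2%:P).
Proof. by move=> tA dA; rewrite char_poly2 tA dA polyCD polyCM; ring. Qed.

Lemma unit2E A : (A \is a GRing.unit) = (\det A != 0).
Proof. by rewrite -[LHS]/(A \in unitmx) unitmxE unitfE. Qed.

Lemma inv2E A : \det A != 0 -> A^-1 = (\det A)^-1 *: ((\tr A)%:M - A).
Proof.
move=> dA; have AU : A \is a GRing.unit by rewrite unit2E.
apply: (mulrI AU); rewrite divrr // -scalerAr mulrBr -expr2 Cayley_Hamilton2.
have -> : A * (\tr A)%:M = \tr A *: A by rewrite -mul_mx_scalar.
rewrite opprB addrCA subrr addr0.
by rewrite scale_scalar_mx mulVf.
Qed.

(** A non-scalar 2 x 2 matrix is cyclic, so its centralizer is spanned by 1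
    and the matrix. The coefficient of g is read off from a nonzero
    off-diagonal entry, or else from the difference of the diagonal entries.
    *)
Lemma commuting2 g h : (forall a, g <> a%:M) -> h * g = g * h ->
  exists a b, h = a%:M + b *: g.
Proof.
move=> ng hg.
have E i j : (h * g) i j = (g * h) i j by rewrite hg.
have := E 0 0; have := E 0 1; have := E 1 0; have := E 1 1; rewrite !mx2E.
move=> E11 E10 E01 E00.
have [g01|g01] := eqVneq (g 0 1) 0; last first.
  exists (h 0 0 - h 0 1 / g 0 1 * g 0 0), (h 0 1 / g 0 1).
  apply: mx2P; rewrite !mx2E; try by field.
    apply: (mulfI g01); apply/eqP; rewrite -subr_eq0; apply/eqP.
    transitivity (g 0 1 * h 1 0 - h 0 1 * g 1 0); first by field.
    by move/eqP: E00; rewrite -subr_eq0 => /eqP E00; rewrite -[RHS]oppr0 -E00; ring.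
  apply: (mulfI g01); apply/eqP; rewrite -subr_eq0; apply/eqP.
  transitivity (g 0 1 * h 1 1 - h 0 0 * g 0 1 + h 0 1 * g 0 0 - h 0 1 * g 1 1).
    by field.
  by move/eqP: E01; rewrite -subr_eq0 => /eqP E01; rewrite -[RHS]oppr0 -E01; ring.
have [g10|g10] := eqVneq (g 1 0) 0; last first.
  exists (h 0 0 - h 1 0 / g 1 0 * g 0 0), (h 1 0 / g 1 0).
  apply: mx2P; rewrite !mx2E; try by field.
    apply: (mulfI g10); apply/eqP; rewrite -subr_eq0; apply/eqP.
    transitivity (g 1 0 * h 0 1 - h 1 0 * g 0 1); first by field.
    by move/eqP: E00; rewrite -subr_eq0 => /eqP E00; rewrite -[RHS]E00; ring.
  apply: (mulfI g10); apply/eqP; rewrite -subr_eq0; apply/eqP.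
  transitivity (g 1 0 * h 1 1 - h 0 0 * g 1 0 + h 1 0 * g 0 0 - h 1 0 * g 1 1).
    by field.
  by move/eqP: E10; rewrite -subr_eq0 => /eqP E10; rewrite -[RHS]E10; ring.
have gd : g 0 0 - g 1 1 != 0.
  apply/eqP => /eqP; rewrite subr_eq0 => /eqP gd; apply: (ng (g 0 0)).
  by apply: mx2P; rewrite !mx2E.
rewrite g01 g10 !mul0r !mulr0 ?addr0 ?add0r in E01 E10.
have h01 : h 0 1 = 0.
  by apply: (mulfI gd); rewrite mulr0 mulrBl [X in _ - X]mulrC E01 subrr.
have h10 : h 1 0 = 0.
  by apply: (mulfI gd); rewrite mulr0 mulrBl -E10 mulrC subrr.
exists (h 0 0 - (h 0 0 - h 1 1) / (g 0 0 - g 1 1) * g 0 0),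
       ((h 0 0 - h 1 1) / (g 0 0 - g 1 1)).
by apply: mx2P; rewrite !mx2E ?g01 ?g10 ?h01 ?h10; field.
Qed.

End Matrix2Field.

(** * Complex coordinates and roots of unity *)

Section Coordinates.
Context {K : rcfType}.
Implicit Types (x y : K[i]).

Lemma cxP x y : Re x = Re y -> Im x = Im y -> x = y.
Proof. by case: x y => [a b] [c d] /= -> ->. Qed.

Lemma ReD x y : Re (x + y) = Re x + Re y. Proof. by case: x y => ? ? []. Qed.
Lemma ImD x y : Im (x + y) = Im x + Im y. Proof. by case: x y => ? ? []. Qed.
Lemma ReN x : Re (- x) = - Re x. Proof. by case: x. Qed.
Lemma ImN x : Im (- x) = - Im x. Proof. by case: x. Qed.
Lemma ReM x y : Re (x * y) = Re x * Re y - Im x * Im y.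
Proof. by case: x y => ? ? []. Qed.
Lemma ImM x y : Im (x * y) = Re x * Im y + Im x * Re y.
Proof. by case: x y => ? ? []. Qed.
Lemma ReZ (m : int) : Re (m%:~R : K[i]) = m%:~R.
Proof. by rewrite -(rmorph_int (real_complex K)). Qed.
Lemma ImZ (m : int) : Im (m%:~R : K[i]) = 0.
Proof. by rewrite -(rmorph_int (real_complex K)). Qed.
Lemma Re_nat (m : nat) : Re (m%:R : K[i]) = m%:R.
Proof. by rewrite -(rmorph_nat (real_complex K)). Qed.
Lemma Im_nat (m : nat) : Im (m%:R : K[i]) = 0.
Proof. by rewrite -(rmorph_nat (real_complex K)). Qed.
Lemma Re1 : Re (1 : K[i]) = 1. Proof. by []. Qed.
Lemma Im1 : Im (1 : K[i]) = 0. Proof. by []. Qed.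
Lemma Re0 : Re (0 : K[i]) = 0. Proof. by []. Qed.
Lemma Im0 : Im (0 : K[i]) = 0. Proof. by []. Qed.

Definition cxE := (ReD, ImD, ReN, ImN, ReM, ImM, ReZ, ImZ, Re_nat, Im_nat,
  Re1, Im1, Re0, Im0).

(** The real number |x|^2, kept in [K] because the order on [K[i]] is partial.
    *)
Definition sqnorm x : K := Re x ^+ 2 + Im x ^+ 2.

Lemma sqnorm_ge0 x : 0 <= sqnorm x.
Proof. by rewrite addr_ge0 ?sqr_ge0. Qed.

Lemma sqnormM x y : sqnorm (x * y) = sqnorm x * sqnorm y.
Proof. by rewrite /sqnorm !cxE; ring. Qed.

Lemma sqnorm_conj x : x * x^*%C = (sqnorm x)%:C.
Proof. by apply: cxP; rewrite /sqnorm; case: x => a b; rewrite !cxE /=; ring. Qed.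

Lemma sqnorm1 : sqnorm 1 = 1.
Proof. by rewrite /sqnorm !cxE; ring. Qed.

Lemma sqnorm_root x n : (0 < n)%N -> x ^+ n = 1 -> sqnorm x = 1.
Proof.
move=> n0 xn; have E : sqnorm x ^+ n = 1.
  have sX m : sqnorm (x ^+ m) = sqnorm x ^+ m.
    by elim: m => [|m IH]; rewrite ?expr0 ?sqnorm1 // !exprS sqnormM IH.
  by rewrite -sX xn sqnorm1.
by apply/eqP; rewrite -(eqrXn2 n0 (sqnorm_ge0 x) ler01) E expr1n.
Qed.

Lemma conj_inv_unit x : sqnorm x = 1 -> x^*%C = x^-1.
Proof.
move=> x1; have x0 : x != 0 by apply/eqP => x0; move: x1; rewrite x0 /sqnorm !cxE; lra.
by apply: (mulfI x0); rewrite sqnorm_conj x1 divff.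
Qed.

End Coordinates.

Section RootsOfUnity.
Context {K : realType}.
Local Notation C := K[i].

Lemma cisD (a b : K) : cis (a + b) = cis a * cis b.
Proof. by apply: cxP; rewrite !cxE /= ?cosD ?sinD; ring. Qed.

Lemma cisN (a : K) : cis (- a) * cis a = 1.
Proof. by rewrite -cisD addNr /cis cos0 sin0. Qed.

Lemma cisMn (a : K) n : cis (a *+ n) = cis a ^+ n.
Proof.
elim: n => [|n IH]; first by rewrite mulr0n expr0 /cis cos0 sin0.
by rewrite mulrS exprS cisD IH.
Qed.

Lemma cis_pi : cis (pi : K) = -1.
Proof. by apply: cxP; rewrite !cxE /= ?cospi ?sinpi //; ring. Qed.

Lemma cis_pihalf : cis (pi / 2 : K) = 0 +i* 1.
Proof. by rewrite /cis cos_pihalf sin_pihalf. Qed.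

Definition zeta6 : C := cis (pi / 3).
Definition zeta12 : C := cis (pi / 6).
Definition sqrt3 : K := Num.sqrt 3.

Lemma sqrt3_sqr : sqrt3 ^+ 2 = 3. Proof. by rewrite sqr_sqrtr. Qed.
Lemma sqrt3_gt0 : 0 < sqrt3. Proof. by rewrite sqrtr_gt0. Qed.

Lemma zeta6_cube : zeta6 ^+ 3 = -1.
Proof. by rewrite -cisMn -cis_pi; congr cis; field. Qed.

(** The cube of zeta6 is -1 and zeta6 is not -1, its imaginary part being
    positive; so it is the root of X^2 - X + 1 in the upper half plane. *)
Lemma zeta6E : zeta6 = 2^-1 +i* (sqrt3 / 2).
Proof.
have s0 : 0 < sin (pi / 3 : K).
  by have := @pi_gt0 K => p; apply: sin_gt0_pi; apply/andP; split; lra.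
have z3 := zeta6_cube; set z := zeta6 in z3 *.
have zI : Im z = sin (pi / 3) by [].
have : z ^+ 2 = z - 1.
  have z1 : z + 1 != 0.
    by apply/eqP => /(congr1 (@complex.Im K)); rewrite !cxE zI; lra.
  apply: (mulfI z1); apply/eqP; rewrite -subr_eq0; apply/eqP.
  by transitivity (z ^+ 3 + 1); [ring | rewrite z3 addNr].
move=> z2; have := congr1 (@complex.Re K) z2; have := congr1 (@complex.Im K) z2.
rewrite expr2 !cxE zI; set s := sin _ in s0 zI *; set c := complex.Re z => E1 E2.
have cE : c = 2^-1.
  have : s * (2 * c - 1) = 0 by rewrite -[RHS](subrr s) -{2}[s]subr0 -E1; ring.
  by move/eqP; rewrite mulf_eq0 gt_eqF //= => /eqP; lra.
have sE : s = sqrt3 / 2.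
  apply/eqP; rewrite -(eqrXn2 (_ : 0 < 2)%N) ?(ltW s0) //.
    apply/eqP; rewrite exprMn sqrt3_sqr; move: E2; rewrite cE; lra.
  by have := sqrt3_gt0; lra.
by apply: cxP; rewrite /= ?zI.
Qed.
End RootsOfUnity.

Section SixthRoots.
Context {K : realType}.
Local Notation C := K[i].
Local Notation zeta6 := (@zeta6 K).
Local Notation zeta12 := (@zeta12 K).
Local Notation theta := (sqrtN 3 : C).

Lemma thetaE : theta = 0 +i* sqrt3. Proof. by []. Qed.

Lemma theta_zeta6 : theta = 2 * zeta6 - 1.
Proof. by apply: cxP; rewrite zeta6E !cxE /= /sqrt3; field. Qed.

Lemma theta_sqr : theta ^+ 2 = - 3.
Proof.
have s := @sqrt3_sqr K; rewrite thetaE.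
by apply: cxP; rewrite expr2 !cxE /=; [rewrite mul0r sub0r -expr2 s|ring].
Qed.

Lemma theta_neq0 : theta != 0.
Proof. by rewrite -sqrf_eq0 theta_sqr oppr_eq0 pnatr_eq0. Qed.

Lemma zeta6_sqr : zeta6 ^+ 2 = zeta6 - 1.
Proof.
apply: (mulfI (_ : (4 : C) != 0)); first by rewrite pnatr_eq0.
have -> : 4 * zeta6 ^+ 2 = (2 * zeta6 - 1) ^+ 2 + 4 * zeta6 - 1 by ring.
by rewrite -theta_zeta6 theta_sqr; ring.
Qed.

Lemma zeta6_neq0 : zeta6 != 0.
Proof.
by apply/eqP => z0; have /eqP := zeta6_cube (K := K);
  rewrite z0 expr0n /= eq_sym oppr_eq0 oner_eq0.
Qed.

Lemma zeta6_inv : zeta6^-1 = 1 - zeta6.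
Proof.
apply: (mulfI zeta6_neq0); rewrite divff ?zeta6_neq0 // mulrBr mulr1 -expr2.
by rewrite zeta6_sqr; ring.
Qed.

Lemma zeta12_sqr : zeta12 ^+ 2 = zeta6.
Proof. by rewrite -cisMn; congr cis; field. Qed.

Lemma zeta12_cube : zeta12 ^+ 3 = 0 +i* 1.
Proof. by rewrite -cisMn -cis_pihalf; congr cis; field. Qed.

End SixthRoots.

(** * Orders in the complex numbers *)

Section Orders.
Context {K : realType}.
Local Notation C := K[i].
Local Notation zeta6 := (@zeta6 K).
Local Notation theta := (sqrtN 3 : C).
Implicit Types (R : set C) (a b x y z : C).

Definition is_subring R : Prop :=
  [/\ R 1, forall x y, R x -> R y -> R (x - y)
    & forall x y, R x -> R y -> R (x * y)].

Section Subring.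
Variables (R : set C) (Rs : is_subring R).

Lemma sr1 : R 1. Proof. by case: Rs. Qed.
Lemma srB x y : R x -> R y -> R (x - y). Proof. by case: Rs => _ + _; apply. Qed.
Lemma srM x y : R x -> R y -> R (x * y). Proof. by case: Rs => _ _; apply. Qed.
Lemma sr0 : R 0. Proof. by rewrite -(subrr 1); apply: srB; exact: sr1. Qed.
Lemma srN x : R x -> R (- x).
Proof. by move=> Rx; rewrite -sub0r; apply: srB => //; exact: sr0. Qed.
Lemma srD x y : R x -> R y -> R (x + y).
Proof. by move=> Rx Ry; rewrite -[y]opprK; apply: srB => //; exact: srN. Qed.
Lemma sr_nat n : R n%:R.
Proof.
elim: n => [|n IH]; first exact: sr0.
by rewrite mulrS; apply: srD => //; exact: sr1.
Qed.
Lemma sr_int (m : int) : R m%:~R.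
Proof. by case: m => n; [exact: sr_nat | rewrite NegzE mulrNz; exact/srN/sr_nat]. Qed.
Lemma srX x n : R x -> R (x ^+ n).
Proof.
by move=> Rx; elim: n => [|n IH]; [exact: sr1 | rewrite exprS; exact: srM].
Qed.

End Subring.

(** The part of the structure of an order in an imaginary quadratic field, or
    of the ring of integers, that the classification uses: every element has
    an integral trace and an integral norm. *)
Definition is_order R : Prop := is_subring R /\
  forall a, R a -> exists m n : int, Re a *+ 2 = m%:~R /\ sqnorm a = n%:~R.

(** Multiplication by a acts on the basis w1, w2 by an integral matrix, and a
    is a root of its characteristic polynomial. If a is not real, the other
    root is its conjugate, so 2 Re a and |a|^2 are the trace and the
    determinant of the matrix; if a is real, freeness of the basis makes it an
    integer. *)
Lemma elliptic_End_is_order R : is_elliptic_End R -> is_order R.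
Proof.
move=> [w1 [w2 [wfree ->]]].
have Lsub z z' : lattice w1 w2 z -> lattice w1 w2 z' -> lattice w1 w2 (z - z').
  move=> [a _ [b _ <-]] [a' _ [b' _ <-]].
  by exists (a - a') => //; exists (b - b') => //; rewrite !rmorphB /=; ring.
split.
  split.
  - by move=> z; rewrite mul1r.
  - by move=> x y Rx Ry z Lz; rewrite mulrBl; apply: Lsub; [exact: Rx|exact: Ry].
  - by move=> x y Rx Ry z Lz; rewrite -mulrA; apply/Rx/Ry.
move=> a Ra.
have L1 : lattice w1 w2 w1.
  by exists 1 => //; exists 0 => //; rewrite mul1r mul0r addr0.
have L2 : lattice w1 w2 w2.
  by exists 0 => //; exists 1 => //; rewrite mul1r mul0r add0r.
have [p _ [q _ E1]] := Ra _ L1; have [r _ [s _ E2]] := Ra _ L2.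
have w1_neq0 : w1 != 0.
  apply/eqP => w10; have [] := wfree 1 0; first by rewrite w10 mulr0 mul0r addr0.
  by move/eqP; rewrite oner_eq0.
have E : (a - p%:~R) * (a - s%:~R) = (q * r)%:~R.
  apply: (mulIf w1_neq0); rewrite rmorphM /=.
  have Eq1 : (a - p%:~R) * w1 = q%:~R * w2 by rewrite mulrBl -E1; ring.
  have Eq2 : (a - s%:~R) * w2 = r%:~R * w1 by rewrite mulrBl -E2; ring.
  transitivity ((a - s%:~R) * ((a - p%:~R) * w1)); first by ring.
  by rewrite Eq1 mulrCA Eq2 mulrA.
have [y0|y0] := eqVneq (Im a) 0.
  have aE : a = (Re a)%:C by apply: cxP; rewrite /= ?y0.
  have [] := wfree (Re a - p%:~R) (- q%:~R).
    rewrite rmorphB rmorphN /= !rmorph_int -aE mulrBl -E1; ring.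
  move/eqP; rewrite subr_eq0 => /eqP xp _.
  exists (p *+ 2), (p * p); rewrite /sqnorm y0 xp !rmorphM !rmorphMn /=; split; ring.
have := congr1 (@complex.Im K) E; have := congr1 (@complex.Re K) E.
rewrite !cxE !rmorphM /= => F1 F2.
have xE : Re a *+ 2 = (p + s)%:~R.
  apply: (mulfI y0); rewrite rmorphD /=; apply/eqP; rewrite -subr_eq0; apply/eqP.
  by rewrite -[RHS]F2; ring.
exists (p + s), (p * s - q * r); split=> //.
rewrite /sqnorm rmorphB !rmorphM /= -F1; move: xE; rewrite rmorphD /=.
set P := p%:~R; set S := s%:~R; set X := complex.Re a; set Y := complex.Im a => xE.
have -> : S = X *+ 2 - P by rewrite xE; ring.
ring.
Qed.

Lemma int_parity (m : int) : exists u : int, m = u * 2 \/ m = u * 2 + 1.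
Proof. by exists (m %/ 2)%Z; lia. Qed.

Lemma int_mod3 (m : int) :
  exists u : int, [\/ m = u * 3, m = u * 3 + 1 | m = u * 3 + 2].
Proof.
exists (m %/ 3)%Z.
have H1 := @ltz_pmod m 3 isT; have H2 := @modz_ge0 m 3 isT.
have [E|[E|E]] : (m %% 3)%Z = 0 \/ (m %% 3)%Z = 1 \/ (m %% 3)%Z = 2 by lia.
- by constructor 1; lia.
- by constructor 2; lia.
- by constructor 3; lia.
Qed.

(** A square is 0 or 1 modulo 4. *)
Lemma sum_sqr_dvd4 (m n N : int) : m * m + n * n = N * 4 ->
  exists u v : int, m = u * 2 /\ n = v * 2.
Proof.
have [u [->|->]] := int_parity m; have [v [->|->]] := int_parity n => E;
  by [exists u, v | lia].
Qed.

(** The traces of a and of a i say that 2 a is a Gaussian integer, and the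
    integrality of |a|^2 then forces both of its coordinates to be even. *)
Lemma gaussian_of_i R : is_order R -> R (0 +i* 1) -> R = gaussian_integers.
Proof.
move=> [Rs Ro] Ri; apply/seteqP; split=> [a Ra|_ [m _ [n _ <-]]]; last first.
  have -> : m%:~R +i* n%:~R = m%:~R + n%:~R * (0 +i* 1) :> C.
    by apply: cxP; rewrite !cxE /=; ring.
  by apply: (srD Rs); [|apply: (srM Rs)] => //; exact: sr_int.
have [m [N [xE NE]]] := Ro _ Ra.
have [n [N' [yE _]]] := Ro _ (srM Rs Ra Ri).
move: yE; rewrite cxE /= => yE.
have {}yE : Im a *+ 2 = (- n)%:~R by rewrite rmorphN /= -yE; ring.
have : (m * m + n * n)%:~R = (N * 4)%:~R :> K.
  rewrite rmorphD !rmorphM /= -NE -xE.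
  have -> : n%:~R = - (Im a *+ 2) :> K by rewrite yE rmorphN opprK.
  by rewrite /sqnorm; ring.
move/eqP; rewrite eqr_int => /eqP E.
have [u [v [mE nE]]] := sum_sqr_dvd4 E.
exists u => //; exists (- v) => //; apply: cxP => /=.
  by move: xE; rewrite mE rmorphM /=; lra.
by move: yE; rewrite nE !rmorphN rmorphM /=; lra.
Qed.

Definition eisenstein : set C :=
  [set a%:~R + b%:~R * zeta6 | a in [set: int] & b in [set: int]].

End Orders.

(** * The Eisenstein integers *)

Section Eisenstein.
Context {K : realType}.
Local Notation C := K[i].
Local Notation zeta6 := (@zeta6 K).
Local Notation theta := (sqrtN 3 : C).
Local Notation eisenstein := (@eisenstein K).
Implicit Types (R : set C) (x y z : C).

Lemma Re_eis (a b : int) : Re (a%:~R + b%:~R * zeta6) = a%:~R + b%:~R / 2.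
Proof. by rewrite zeta6E !cxE /=; ring. Qed.
Lemma Im_eis (a b : int) : Im (a%:~R + b%:~R * zeta6) = b%:~R * sqrt3 / 2.
Proof. by rewrite zeta6E !cxE /=; ring. Qed.

Lemma sqnorm_eis (a b : int) :
  sqnorm (a%:~R + b%:~R * zeta6) = (a * a + a * b + b * b)%:~R :> K.
Proof.
have s3 := @sqrt3_sqr K; rewrite /sqnorm Re_eis Im_eis !rmorphD !rmorphM /=.
by rewrite !exprMn s3; field.
Qed.

(** Modulo 3, n is divisible by 3; dividing by 3, the equation modulo 4 says
    that m and n / 3 have the same parity. *)
Lemma eis_arith (m n N : int) : m * m * 3 + n * n = N * 12 ->
  exists a b : int, n = b * 3 /\ m = a * 2 + b.
Proof.
move=> E; have [b nE] : exists b : int, n = b * 3.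
  by have [u [nE|nE|nE]] := int_mod3 n; [exists u | |]; move: E; rewrite nE //; lia.
have {}E : m * m + b * b * 3 = N * 4 by move: E; rewrite nE; lia.
have [u mE] := int_parity m; have [v bE] := int_parity b.
case: mE => mE; case: bE => bE; move: E; rewrite mE bE => E; try (exfalso; lia).
- by exists (u - v), (v * 2); rewrite nE bE; split=> //; lia.
- by exists (u - v), (v * 2 + 1); rewrite nE bE; split=> //; lia.
Qed.

(** The second hypothesis is the trace of x sqrt(-3) up to sign. *)
Lemma eisenstein_crit x (m n N : int) : Re x *+ 2 = m%:~R ->
  Im x * sqrt3 *+ 2 = n%:~R -> sqnorm x = N%:~R -> eisenstein x.
Proof.
have s3 := @sqrt3_sqr K; have s0 := @sqrt3_gt0 K.
move=> xE yE NE; have : (m * m * 3 + n * n)%:~R = (N * 12)%:~R :> K.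
  rewrite rmorphD !rmorphM /= -xE -yE -NE /sqnorm.
  transitivity (Re x ^+ 2 * 12 + Im x ^+ 2 * sqrt3 ^+ 2 * 4); first by ring.
  by rewrite s3; ring.
move/eqP; rewrite eqr_int => /eqP /eis_arith[a [b [nE mE]]].
exists a => //; exists b => //; apply: cxP; rewrite ?Re_eis ?Im_eis.
  by move: xE; rewrite mE rmorphD rmorphM /=; lra.
apply: (mulIf (_ : sqrt3 != 0 :> K)); first by rewrite gt_eqF.
move: yE; rewrite nE rmorphM /= => yE.
have -> : b%:~R * sqrt3 / 2 * sqrt3 = b%:~R / 2 * sqrt3 ^+ 2 :> K by ring.
by rewrite s3; lra.
Qed.

Lemma eisenstein_subring : is_subring eisenstein.
Proof.
have z2 := @zeta6_sqr K; split.
- by exists 1 => //; exists 0 => //; rewrite mul0r addr0.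
- move=> _ _ [a _ [b _ <-]] [a' _ [b' _ <-]].
  by exists (a - a') => //; exists (b - b') => //; rewrite !rmorphB /=; ring.
- move=> _ _ [a _ [b _ <-]] [a' _ [b' _ <-]].
  exists (a * a' - b * b') => //; exists (a * b' + b * a' + b * b') => //.
  rewrite !(rmorphB, rmorphD, rmorphM) /=.
  transitivity (a%:~R * a'%:~R + (a%:~R * b'%:~R + b%:~R * a'%:~R) * zeta6
                + b%:~R * b'%:~R * zeta6 ^+ 2); last by ring.
  by rewrite z2; ring.
Qed.

Lemma eisenstein_zeta6 : eisenstein zeta6.
Proof. by exists 0 => //; exists 1 => //; rewrite add0r mul1r. Qed.

Lemma eisenstein_min R : is_subring R -> R zeta6 -> eisenstein `<=` R.
Proof.
move=> Rs Rz _ [a _ [b _ <-]].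
by apply: (srD Rs); [|apply: (srM Rs)] => //; exact: sr_int.
Qed.

Lemma eisenstein_of_zeta6 R : is_order R -> R zeta6 -> R = eisenstein.
Proof.
move=> [Rs Ro] Rz; apply/seteqP; split; last exact: eisenstein_min.
move=> x Rx; have [m [N [xE NE]]] := Ro _ Rx.
have [k [_ [kE _]]] := Ro _ (srM Rs Rx Rz).
apply: (@eisenstein_crit x m (m - k * 2) N) => //.
move: kE; rewrite rmorphB rmorphM /= -xE => <-; rewrite zeta6E !cxE /=.
by field.
Qed.

(** Such an order lies between Z + Z sqrt(-3) and the Eisenstein integers, and
    the former has index 2 in the latter. *)
Lemma order_of_theta R : is_order R -> R theta ->
  R = eisenstein \/ R = [set m%:~R + n%:~R * theta | m in [set: int] & n in [set: int]].
Proof.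
move=> Rord Rt; have [Rs Ro] := Rord.
have Reis : R `<=` eisenstein.
  move=> x Rx; have [m [N [xE NE]]] := Ro _ Rx.
  have [k [_ [kE _]]] := Ro _ (srM Rs Rx Rt).
  apply: (@eisenstein_crit x m (- k) N) => //.
  by rewrite rmorphN /= -kE thetaE !cxE /=; ring.
have R2z : R (2 * zeta6).
  have -> : 2 * zeta6 = theta + 1 by rewrite theta_zeta6; ring.
  by apply: (srD Rs) => //; exact: sr1.
have [Rz|Rz] := pselect (R zeta6); [left|right].
  exact: eisenstein_of_zeta6.
apply/seteqP; split=> [x Rx|_ [m _ [n _ <-]]]; last first.
  by apply: (srD Rs); [|apply: (srM Rs)] => //; exact: sr_int.
have [a _ [b _ xE]] := Reis x Rx.
have [u [bE|bE]] := int_parity b.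
  exists (a + u) => //; exists u => //.
  by rewrite -xE bE theta_zeta6 rmorphD rmorphM /=; ring.
case: Rz; have -> : zeta6 = x - a%:~R - u%:~R * (2 * zeta6).
  by rewrite -xE bE rmorphD rmorphM /=; ring.
apply: (srB Rs); first by apply: (srB Rs) => //; exact: sr_int.
by apply: (srM Rs) => //; exact: sr_int.
Qed.

(** The monic polynomial P is divisible over Q by X - p, and by the Gauss
    lemma over Z by an integral multiple of X - p, whose leading coefficient
    divides 1. *)
Lemma integral_rat_int (p : rat) :
  integralOver (intr : int -> C) (ratr p) -> exists m : int, p = m%:~R.
Proof.
move=> [P Pmon]; rewrite -(eq_map_poly (f := ratr \o intr)); last first.
  by move=> m /=; rewrite ratr_int.
rewrite map_poly_comp fmorph_root -dvdp_XsubCl => /dvdpP_rat_int[P1 [a a0 E] [P2 PE]].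
have lP2 : lead_coef P1 * lead_coef P2 = 1 by rewrite -lead_coefM -PE; apply/monicP.
have lP1 : lead_coef P1 = 1 \/ lead_coef P1 = - 1.
  have : `|lead_coef P1|%N = 1%N.
    by have /eqP := congr1 absz lP2; rewrite abszM muln_eq1 => /andP[/eqP].
  by case: (lead_coef P1) => [[|[|?]]|[|?]] //= _; [left|right].
have aE : a * (lead_coef P1)%:~R = 1.
  have := congr1 lead_coef E; rewrite lead_coefXsubC lead_coefZ.
  by rewrite (lead_coef_map_inj intr_inj (rmorph0 _)) => <-.
have pE : - p = a * (P1`_0)%:~R.
  by have := congr1 (fun q : {poly rat} => q`_0) E; rewrite coefB coefX coefC coefZ coef_map /= sub0r.
exists (- (lead_coef P1 * P1`_0)); rewrite rmorphN rmorphM /=.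
have -> : (lead_coef P1)%:~R = a.
  move: aE; case: lP1 => ->; rewrite ?rmorphN ?rmorph1 ?mulr1 ?mulrN1 //.
  by move/eqP; rewrite eqr_oppLR => /eqP.
by rewrite -pE opprK.
Qed.

(** The set of these numbers is a field: the inverse of p + q sqrt(-d) is its
    conjugate divided by the rational norm p^2 + q^2 d. *)
Lemma Q_sqrtN_rat d x : Q_sqrtN d x ->
  exists p q : rat, x = ratr p + ratr q * sqrtN d :> C.
Proof.
have sq : (sqrtN d : C) ^+ 2 = - (d%:R).
  rewrite /sqrtN; have := sqr_sqrtr (ler0n K d); set r := Num.sqrt _ => rE.
  by apply: cxP; rewrite expr2 !cxE /=; [rewrite mul0r sub0r -expr2 rE | ring].
move=> /(_ [set x : C | exists p q : rat, x = ratr p + ratr q * sqrtN d]).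
apply; split; last first.
  by move=> _ ->; exists 0, 1; rewrite rmorph0 rmorph1 add0r mul1r.
have Fmul y z : (exists p q : rat, y = ratr p + ratr q * sqrtN d :> C) ->
    (exists p q : rat, z = ratr p + ratr q * sqrtN d :> C) ->
    exists p q : rat, y * z = ratr p + ratr q * sqrtN d :> C.
  move=> [p [q ->]] [p' [q' ->]].
  exists (p * p' - q * q' * d%:R), (p * q' + q * p').
  rewrite rmorphB rmorphD !rmorphM rmorph_nat /=.
  transitivity (ratr p * ratr p' + (ratr p * ratr q' + ratr q * ratr p') * sqrtN d
     + ratr q * ratr q' * sqrtN d ^+ 2 : C); first by ring.
  by rewrite sq; ring.
split.
- by exists 1, 0; rewrite rmorph0 rmorph1 mul0r addr0.
- move=> _ _ [p [q ->]] [p' [q' ->]]; exists (p - p'), (q - q').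
  by rewrite !rmorphB /=; ring.
move=> y z Fy [p [q zE]]; apply: Fmul => //.
have [z0|z0] := eqVneq z 0.
  by rewrite z0 invr0; exists 0, 0; rewrite rmorph0 mul0r addr0.
pose N : rat := p ^+ 2 + q ^+ 2 * d%:R.
have NE : z * (ratr p - ratr q * sqrtN d) = ratr N :> C.
  rewrite zE /N !expr2 rmorphD !rmorphM rmorph_nat /=.
  transitivity (ratr p ^+ 2 - ratr q ^+ 2 * sqrtN d ^+ 2 : C); first by ring.
  by rewrite sq; ring.
have N0 : ratr N != 0 :> C.
  rewrite fmorph_eq0; apply/eqP => /eqP.
  have q2 : 0 <= q ^+ 2 * d%:R by apply: mulr_ge0; rewrite ?sqr_ge0 ?ler0n.
  rewrite /N paddr_eq0 ?sqr_ge0 // => /andP[].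
  rewrite sqrf_eq0 mulf_eq0 sqrf_eq0 => /eqP p0 q0.
  move: z0; rewrite zE p0 rmorph0 add0r; case/orP: q0 => /eqP q0.
    by rewrite q0 rmorph0 mul0r eqxx.
  have d0 : (sqrtN d : C) = 0 by apply/eqP; rewrite -sqrf_eq0 sq -(rmorph_nat (ratr : rat -> C)) q0 rmorph0 oppr0.
  by rewrite d0 mulr0 eqxx.
exists (p / N), (- q / N); apply: (mulfI z0); rewrite divff //.
rewrite !fmorph_div /= rmorphN.
by rewrite -(divff N0) -{1}NE; ring.
Qed.

Lemma is_subfield_subring R : is_subfield R -> is_subring R.
Proof.
move=> [R1 RB Rd]; split=> // x y Rx Ry.
by rewrite -[y]invrK -[y^-1]mul1r; apply: (Rd) => //; apply: Rd.
Qed.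

Lemma Q_adjoin_subfield (S : set C) : is_subfield (Q_adjoin S).
Proof.
split.
- by move=> F [[]].
- by move=> x y Fx Fy F FS; have [[_ + _] _] := FS; apply; [exact: Fx|exact: Fy].
- by move=> x y Fx Fy F FS; have [[_ _ +] _] := FS; apply; [exact: Fx|exact: Fy].
Qed.

Lemma Q_adjoin_gen (S : set C) : S `<=` Q_adjoin S.
Proof. by move=> x Sx F [_]; apply. Qed.

Lemma eisenstein_integral x : eisenstein x -> integralOver (intr : int -> C) x.
Proof.
have z2 := @zeta6_sqr K.
move=> [a _ [b _ <-]]; pose t : int := a *+ 2 + b; pose N : int := a * a + a * b + b * b.
exists ('X^2 - t *: 'X + N%:P); last first.
  rewrite rmorphD rmorphB /= map_polyXn map_polyZ map_polyX map_polyC /=.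
  rewrite rootE !hornerE /t /N !(rmorphD, rmorphMn, rmorphM) /=.
  apply/eqP; transitivity (b%:~R ^+ 2 * (zeta6 ^+ 2 - zeta6 + 1)); first by ring.
  by rewrite z2; ring.
rewrite -addrA monicE lead_coefDl ?lead_coefXn // size_polyXn.
apply: (leq_ltn_trans (size_polyD _ _)).
rewrite gtn_max size_polyN (leq_ltn_trans (size_scale_leq _ _)) ?size_polyX //=.
exact: leq_ltn_trans (size_polyC_leq1 _) _.
Qed.

(** An integral x = p + q sqrt(-3) has an integral conjugate, so the rational
    numbers 2 p, - 6 q and p^2 + 3 q^2, which are the traces of x and x
    sqrt(-3) and the norm of x, are integers; these are the hypotheses of
    [eisenstein_crit]. *)
Lemma ring_of_integers3 : ring_of_integers 3 = eisenstein.
Proof.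
have Qsr := is_subfield_subring (Q_adjoin_subfield [set (sqrtN 3 : C)]).
apply/seteqP; split=> [x [Qx xint]|x eisx]; last first.
  split; last exact: eisenstein_integral.
  apply: (eisenstein_min Qsr) eisx.
  have -> : zeta6 = (theta + 1) / 2%:R by rewrite theta_zeta6; field.
  have [_ _ Qdiv] := Q_adjoin_subfield [set (sqrtN 3 : C)].
  apply: Qdiv; last exact: sr_nat.
  by apply: (srD Qsr); [exact: Q_adjoin_gen|exact: sr1].
have [p [q xE]] := Q_sqrtN_rat Qx.
have tint : integralOver (intr : int -> C) theta.
  apply: eisenstein_integral; exists (-1) => //; exists 2 => //.
  by rewrite theta_zeta6; ring.
have cint (y : C) : integralOver (intr : int -> C) y ->
    integralOver (intr : int -> C) y^*%C.
  move=> [P Pm Py]; exists P => //.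
  rewrite -(eq_map_poly (f := (@conjc K) \o intr)); last first.
    by move=> m /=; rewrite (rmorph_int (@conjc K)).
  by rewrite map_poly_comp fmorph_root.
have ratrE (r : rat) : (ratr r : C) = (ratr r : K)%:C.
  exact/esym/(fmorph_eq_rat (real_complex K \o ratr)).
have xRe : Re x = ratr p by rewrite xE !ratrE !cxE /=; ring.
have xIm : Im x = ratr q * sqrt3 by rewrite xE !ratrE thetaE !cxE /=; ring.
have s3 := @sqrt3_sqr K.
have qs3 : (ratr q * sqrt3) ^+ 2 = ratr q ^+ 2 * 3 :> K.
  by transitivity (ratr q ^+ 2 * sqrt3 ^+ 2 : K); [ring|rewrite s3].
have intE (y : C) (r : rat) : integralOver (intr : int -> C) y -> y = ratr r ->
    exists m : int, ratr r = m%:~R :> K.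
  by move=> + yE; rewrite yE => /integral_rat_int[m ->]; exists m; rewrite ratr_int.
(* the trace of x *)
have [m mE] : exists m : int, ratr (p *+ 2) = m%:~R :> K.
  apply: (intE (x + x^*%C)); first by apply: integral_add => //; exact: cint.
  by rewrite ratrE rmorphMn /= -xRe; apply: cxP; case: (x) => ? ?; rewrite !cxE /=; ring.
(* the trace of x sqrt(-3) *)
have [n nE] : exists n : int, ratr (- (q * 6)) = n%:~R :> K.
  apply: (intE (x * theta + (x * theta)^*%C)).
    by apply: integral_add; [|apply: cint]; exact: integral_mul.
  have -> : ratr (- (q * 6)) = (- (Im x * sqrt3 *+ 2))%:C :> C.
    rewrite ratrE xIm rmorphN rmorphM rmorph_nat /=.
    congr ((- _)%:C); transitivity (ratr q * sqrt3 ^+ 2 * 2 : K); last by ring.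
    by rewrite s3; ring.
  by rewrite thetaE; apply: cxP; case: (x) => ? ?; rewrite !cxE /=; ring.
have [N NE] : exists N : int, ratr (p ^+ 2 + q ^+ 2 * 3) = N%:~R :> K.
  apply: (intE (x * x^*%C)); first by apply: integral_mul => //; exact: cint.
  rewrite sqnorm_conj ratrE; congr (_%:C).
  by rewrite /sqnorm xRe xIm qs3 rmorphD rmorphM rmorph_nat !rmorphXn.
apply: (@eisenstein_crit x m (- n) N).
- by rewrite xRe -mE rmorphMn.
- rewrite rmorphN /= -nE xIm !rmorphN rmorphM rmorph_nat opprK /=.
  transitivity (ratr q * sqrt3 ^+ 2 * 2 : K); first by ring.
  by rewrite s3; ring.
- by rewrite -NE /sqnorm xRe xIm qs3 rmorphD rmorphM rmorph_nat !rmorphXn.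
Qed.

Lemma quad_order32 : quad_order 3 2 =
  [set m%:~R + n%:~R * theta | m in [set: int] & n in [set: int]].
Proof.
rewrite /quad_order ring_of_integers3; apply/seteqP; split.
  move=> _ [m _ [_ [a _ [b _ <-]] <-]]; exists (m + a *+ 2 + b) => //; exists b => //.
  by rewrite !(rmorphD, rmorphMn) /= theta_zeta6; ring.
move=> _ [m _ [n _ <-]]; exists (m - n) => //.
exists (n%:~R * zeta6); first by exists 0 => //; exists n => //; rewrite add0r.
by rewrite rmorphB /= theta_zeta6; ring.
Qed.

End Eisenstein.

(** * Elements of order six and their centralizers *)

Section OrderSix.
Context {K : realType}.
Local Notation C := K[i].
Local Notation zeta6 := (@zeta6 K).
Local Notation theta := (sqrtN 3 : C).
Implicit Types (R : set C) (g h : 'M[C]_2).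

Lemma GL2_subgroup R : is_subring R -> is_subgroup (GL2 R).
Proof.
move=> Rs; split.
- move=> x [_ [_ [v _ dv]]]; rewrite unit2E; apply/eqP => d0.
  by move/eqP: dv; rewrite d0 mul0r eq_sym oner_eq0.
- split; first by move=> i j; rewrite mxE; exact: sr_nat.
  by rewrite det1; split; [exact: sr1 | exists 1; rewrite ?mulr1 //; exact: sr1].
- move=> x y [Rx [Rdx [v Rv dv]]] [Ry [Rdy [w Rw dw]]]; split.
    by move=> i j; rewrite mul2E; apply: (srD Rs); apply: (srM Rs).
  rewrite -[x * y]/(x *m y) det_mulmx; split; first exact: (srM Rs).
  by exists (v * w); [exact: (srM Rs) | rewrite mulrACA dv dw mulr1].
- move=> x [Rx [Rdx [v Rv dv]]].
  have d0 : \det x != 0.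
    by apply/eqP => d0; move/eqP: dv; rewrite d0 mul0r eq_sym oner_eq0.
  have vE : v = (\det x)^-1 by apply: (mulfI d0); rewrite divff.
  split.
    move=> i j; rewrite inv2E // -vE !mxE; apply: (srM Rs) => //.
    apply: (srB Rs) => //; case: (i == j); last exact: sr0.
    by rewrite mulr1n tr2E; apply: (srD Rs).
  have -> : \det x^-1 = v by rewrite -[x^-1]/(invmx x) det_inv vE.
  by split=> //; exists (\det x) => //; rewrite mulrC.
Qed.

Lemma det2M g h : \det (g * h) = \det g * \det h.
Proof. exact: det_mulmx. Qed.

Lemma det2X g n : \det (g ^+ n) = \det g ^+ n.
Proof. by elim: n => [|n IH]; rewrite ?expr0 ?det1 // !exprS det2M IH. Qed.

Lemma det2V g : \det g^-1 = (\det g)^-1.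
Proof. exact: det_inv. Qed.

Section TraceOne.
Variables (g : 'M[C]_2).
Hypotheses (tg : \tr g = 1) (dg : \det g = 1).

Lemma tr1_sqr : g ^+ 2 = g - 1.
Proof. by rewrite Cayley_Hamilton2 tg dg scale1r. Qed.

Lemma tr1_cube : g ^+ 3 = -1.
Proof. by rewrite exprS tr1_sqr mulrBr mulr1 -expr2 tr1_sqr addrAC subrr sub0r. Qed.

Lemma tr1_inv : g^-1 = 1 - g.
Proof. by rewrite inv2E dg ?oner_eq0 // invr1 scale1r tg. Qed.

Lemma tr1_pow5 : g ^+ 5 = 1 - g.
Proof. by rewrite (exprD g 3 2) tr1_cube tr1_sqr mulN1r opprB. Qed.

Lemma tr1_not_scalar a : g <> a%:M.
Proof.
move=> gE; have E : a ^+ 2 = a - 1.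
  have := congr1 (fun x : 'M[C]_2 => x 0 0) tr1_sqr.
  by rewrite gE expr2 !mx2E mulr0 addr0.
have a2 : a *+ 2 = 1 by have := tg; rewrite gE tr2E !scalar2E.
have d : a ^+ 2 = 1 by have := dg; rewrite gE det_scalar.
have a2' : a = 2 by rewrite -[a](subrK 1) -E d.
by have /eqP := a2; rewrite a2' -mulrnA (eqr_nat _ 4 1).
Qed.

(** The powers g, g^2 = g - 1, g^3 = -1, g^4 = -g and g^5 = 1 - g differ from
    1 because g is not a scalar. *)
Lemma tr1_has_order6 : has_order g 6.
Proof.
have N1 : (-1 : 'M[C]_2) <> 1.
  move=> E; have := congr1 (fun x : 'M[C]_2 => x 0 0) E; rewrite !mx2E.
  by move/eqP; rewrite eq_sym -subr_eq0 opprK (_ : 1 + 1 = 2%:R) ?pnatr_eq0.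
split=> //; first by rewrite (exprM g 3 2) tr1_cube sqrrN expr1n.
have g1 : g <> 1 by exact: tr1_not_scalar.
have gN : g <> -1.
  by move=> E; apply: (tr1_not_scalar (a := -1)); rewrite E raddfN.
case=> [|[|[|[|[|[|m]]]]]] //= _; apply/eqP.
- by rewrite expr1.
- rewrite tr1_sqr => /eqP; rewrite subr_eq => /eqP E.
  by apply: (tr1_not_scalar (a := 1 + 1)); rewrite E raddfD.
- by rewrite tr1_cube => E; exact: N1.
- by rewrite (exprD g 3 1) tr1_cube expr1 mulN1r => /eqP; rewrite eqr_oppLR => /eqP.
- rewrite tr1_pow5 => /eqP; rewrite subr_eq addrC -subr_eq subrr eq_sym => /eqP E.
  by apply: (tr1_not_scalar (a := 0)); rewrite E raddf0.
Qed.

End TraceOne.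

(** With t the trace, Cayley-Hamilton writes g^6 as t (t^2 - 1) (t^2 - 3) g
    plus a scalar. As g is not a scalar, g^6 = 1 makes both coefficients
    known; the only common solutions are t = 1 and t = -1, and t = -1 gives
    g^3 = 1. *)
Lemma order6_trace g : \det g = 1 -> has_order g 6 -> \tr g = 1.
Proof.
move=> dg [_ g6 gm]; set t := \tr g.
have g2 : g ^+ 2 = t *: g - 1 by rewrite Cayley_Hamilton2 dg.
have ng a : g <> a%:M.
  move=> gE; have := dg; rewrite gE det_scalar => a2.
  have /eqP[] := gm 2%N isT; rewrite gE; apply: mx2P; rewrite expr2 !mx2E;
    rewrite ?mulr0 ?mul0r ?addr0 ?add0r // -expr2 //.
have g3 : g ^+ 3 = (t ^+ 2 - 1) *: g - t *: 1.
  rewrite exprSr g2 mulrBl mul1r -scalerAl -expr2 g2 scalerBr scalerA -expr2.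
  by rewrite scalerBl scale1r addrAC.
have g6E : g ^+ 6 = (t * (t ^+ 2 - 1) * (t ^+ 2 - 3)) *: g
                    + (t ^+ 2 - (t ^+ 2 - 1) ^+ 2) *: 1.
  rewrite (exprM g 3 2) g3; set a := _ - 1.
  have -> : (a *: g - t *: 1) ^+ 2 = (a ^+ 2) *: g ^+ 2 - (2 * a * t) *: g + (t ^+ 2) *: 1.
    by apply: mx2P; rewrite !expr2 !mx2E; ring.
  by rewrite g2 /a; apply: mx2P; rewrite !mx2E; ring.
have t0 : t * (t ^+ 2 - 1) * (t ^+ 2 - 3) = 0.
  (* if the coefficient of g in g^6 were invertible, g would be this scalar *)
  apply: contra_notP (ng ((1 - (t ^+ 2 - (t ^+ 2 - 1) ^+ 2)) /
                          (t * (t ^+ 2 - 1) * (t ^+ 2 - 3)))) => /eqP n0.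
  set b := _ - _ ^+ 2 in g6E *; set a := t * _ * _ in g6E n0 *.
  have E6 : a *: g + b *: 1 = 1 by rewrite -g6E.
  have ag : a *: g = (1 - b)%:M.
    transitivity (1 - b *: (1 : 'M[C]_2)).
      by apply/esym/eqP; rewrite subr_eq E6.
    by rewrite raddfB /= scalemx1.
  by rewrite mulrC -scale_scalar_mx -ag scalerA mulVf // scale1r.
have t1 : t ^+ 2 - (t ^+ 2 - 1) ^+ 2 = 1.
  move: g6E; rewrite t0 scale0r add0r g6 => /(congr1 (fun x : 'M[C]_2 => x 0 0)).
  by rewrite !mx2E mulr1.
move/eqP: t0; rewrite !mulf_eq0 -orbA => /or3P[] /eqP t0.
- have /eqP : (2 : C) = 0.
    rewrite (_ : 2 = 1 - (t ^+ 2 - (t ^+ 2 - 1) ^+ 2)); first by rewrite t1 subrr.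
    by rewrite t0; ring.
  by rewrite pnatr_eq0.
- move/eqP: (t0); rewrite subr_eq0 sqrf_eq1 => /orP[/eqP//|/eqP tN].
  have /eqP[] := gm 3%N isT.
  by rewrite g3 t0 tN scale0r sub0r scaleN1r opprK.
- move/eqP: t1; rewrite -subr_eq0 (_ : _ - 1 = - 2) ?oppr_eq0 ?pnatr_eq0 //.
  move/eqP: t0; rewrite subr_eq0 => /eqP ->; ring.
Qed.

Section Centralizer.
Variables (g : 'M[C]_2).
Hypotheses (tg : \tr g = 1) (dg : \det g = 1).

(** The matrix in the span of 1 and g that has the eigenvalues [l1] and [l2]
    on the eigenlines of g for zeta6 and its inverse. Working with it replaces
    a simultaneous diagonalization. *)
Definition eigen_mx (l1 l2 : C) : 'M[C]_2 :=
  (l1 - (l1 - l2) / theta * zeta6) *: 1 + ((l1 - l2) / theta) *: g.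

Lemma eigen_mxE a b :
  a *: 1 + b *: g = eigen_mx (a + b * zeta6) (a + b * (1 - zeta6)).
Proof.
have t0 := @theta_neq0 K; rewrite /eigen_mx.
have -> : (a + b * zeta6 - (a + b * (1 - zeta6))) / theta = b.
  by rewrite theta_zeta6 in t0 *; field.
by congr (_ *: _ + _); ring.
Qed.

Lemma eigen_mxM l1 l2 l1' l2' :
  eigen_mx l1 l2 * eigen_mx l1' l2' = eigen_mx (l1 * l1') (l2 * l2').
Proof.
have t0 := @theta_neq0 K; have z2 := @zeta6_sqr K.
rewrite {1 2}/eigen_mx.
set b := (l1 - l2) / theta; set a := l1 - _; set b' := (l1' - l2') / theta; set a' := l1' - _.
have E1 : l1 = a + b * zeta6 by rewrite /a; ring.
have E2 : l2 = a + b * (1 - zeta6).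
  by rewrite /a /b; rewrite theta_zeta6 in t0 *; field.
have E1' : l1' = a' + b' * zeta6 by rewrite /a'; ring.
have E2' : l2' = a' + b' * (1 - zeta6).
  by rewrite /a' /b'; rewrite theta_zeta6 in t0 *; field.
clearbody a b a' b'.
transitivity ((a * a' - b * b') *: 1 + (a * b' + b * a' + b * b') *: g).
  rewrite mulrDl !mulrDr -!scalerAl -!scalerAr !mul1r mulr1 -expr2 tr1_sqr //.
  by apply: mx2P; rewrite !mx2E; ring.
rewrite eigen_mxE E1 E2 E1' E2'; congr eigen_mx.
  transitivity ((a + b * zeta6) * (a' + b' * zeta6) - b * b' * (zeta6 ^+ 2 - (zeta6 - 1))).
    by ring.
  by rewrite z2 subrr mulr0 subr0.
transitivity ((a + b * (1 - zeta6)) * (a' + b' * (1 - zeta6)) - b * b' * (zeta6 ^+ 2 - (zeta6 - 1))).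
  by ring.
by rewrite z2 subrr mulr0 subr0.
Qed.

Lemma eigen_mx_scalar c : eigen_mx c c = c%:M.
Proof. by rewrite /eigen_mx subrr mul0r mul0r subr0 scale0r addr0 scalemx1. Qed.

Lemma eigen_mxX l1 l2 n : eigen_mx l1 l2 ^+ n = eigen_mx (l1 ^+ n) (l2 ^+ n).
Proof.
elim: n => [|n IH]; first by rewrite !expr0 eigen_mx_scalar.
by rewrite !exprS IH eigen_mxM.
Qed.

Lemma eigen_mx_g : eigen_mx zeta6 zeta6^-1 = g.
Proof.
by rewrite zeta6_inv -[RHS]add0r -[0](scale0r 1) -[g in RHS]scale1r eigen_mxE
  !add0r !mul1r.
Qed.

Lemma eigen_mx_tr l1 l2 : \tr (eigen_mx l1 l2) = l1 + l2.
Proof.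
have t0 := @theta_neq0 K.
rewrite /eigen_mx mxtraceD !mxtraceZ tg mxtrace1.
by rewrite theta_zeta6 in t0 *; field.
Qed.

Lemma eigen_mx_det l1 l2 : \det (eigen_mx l1 l2) = l1 * l2.
Proof.
apply: (mulfI (_ : (2 : C) != 0)); first by rewrite pnatr_eq0.
have := congr1 (@mxtrace C 2) (Cayley_Hamilton2 (eigen_mx l1 l2)).
rewrite eigen_mxX eigen_mx_tr raddfB /= mxtraceZ eigen_mx_tr mxtrace_scalar => E.
have -> : 2 * \det (eigen_mx l1 l2) = (l1 + l2) * (l1 + l2) - (l1 ^+ 2 + l2 ^+ 2).
  by rewrite E -[\det _ *+ 2]mulr_natl; ring.
by ring.
Qed.

Lemma eigen_mx_inj l1 l2 l1' l2' :
  eigen_mx l1 l2 = eigen_mx l1' l2' -> l1 = l1' /\ l2 = l2'.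
Proof.
move=> E; have Et := congr1 (@mxtrace C 2) E; rewrite !eigen_mx_tr in Et.
have := congr1 (fun x => \tr (g * x)) E.
rewrite -[X in X * _]eigen_mx_g -[X in _ = \tr (X * _)]eigen_mx_g !eigen_mxM !eigen_mx_tr.
rewrite zeta6_inv => Eg.
have t0 := @theta_neq0 K; rewrite theta_zeta6 in t0.
have E1 : l1 = l1'.
  apply: (mulfI t0).
  transitivity (zeta6 * l1 + (1 - zeta6) * l2 - (1 - zeta6) * (l1 + l2)); first by ring.
  by rewrite Eg Et; ring.
by split=> //; move: Et; rewrite E1 => /addrI.
Qed.

Lemma centralizer_eigen_mx h : h * g = g * h ->
  exists l1 l2, h = eigen_mx l1 l2.
Proof.
move=> hg; have [a [b ->]] := commuting2 (tr1_not_scalar tg dg) hg.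
by rewrite -scalemx1 eigen_mxE; eexists; eexists.
Qed.

End Centralizer.

End OrderSix.

(** * From the generators to the seven types *)

Section Extensions.
Context {K : realType}.
Local Notation C := K[i].
Local Notation zeta6 := (@zeta6 K).
Local Notation zeta12 := (@zeta12 K).
Local Notation theta := (sqrtN 3 : C).
Implicit Types (R : set C) (g h : 'M[C]_2).

Lemma has_orderN1 : has_order (-1 : C) 2.
Proof.
split=> //; first by rewrite sqrrN expr1n.
case=> [|[|m]] // _; rewrite expr1 -subr_eq0 -opprD oppr_eq0.
by rewrite (_ : 1 + 1 = 2%:R) ?pnatr_eq0.
Qed.

Lemma imaginary_sqr : (0 +i* 1 : C) ^+ 2 = -1.
Proof. by apply: cxP; rewrite expr2 !cxE /=; ring. Qed.

Lemma has_order_imaginary : has_order (0 +i* 1 : C) 4.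
Proof.
have i2 := imaginary_sqr.
have [_ _ /(_ 1%N isT)] := has_orderN1; rewrite expr1 => N1.
split=> //; first by rewrite (exprM _ 2 2) i2 sqrrN expr1n.
have iI (c : C) : Im c = 0 -> (0 +i* 1 : C) != c.
  by move=> cI; apply/eqP => E; move/eqP: cI; rewrite -E /= oner_eq0.
case=> [|[|[|[|m]]]] // _; first by rewrite expr1 iI.
  by rewrite i2.
by rewrite exprS i2 mulrN1 eqr_oppLR; apply: iI; rewrite !cxE oppr0.
Qed.

Lemma zeta6_real (c : C) : Im c = 0 -> zeta6 != c.
Proof.
move=> cI; apply/eqP => E; have := @sqrt3_gt0 K; move: cI; rewrite -E zeta6E /=; lra.
Qed.

Lemma has_order_zeta6 : has_order zeta6 6.
Proof.
have z2 := @zeta6_sqr K; have z3 := @zeta6_cube K.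
have [_ _ /(_ 1%N isT)] := has_orderN1; rewrite expr1 => N1.
split=> //; first by rewrite (exprM _ 3 2) z3 sqrrN expr1n.
case=> [|[|[|[|[|[|m]]]]]] // _.
- by rewrite expr1 zeta6_real.
- by rewrite z2 subr_eq; apply: zeta6_real; rewrite !cxE addr0.
- by rewrite z3.
- by rewrite exprS z3 mulrN1 eqr_oppLR; apply: zeta6_real; rewrite !cxE oppr0.
- rewrite (exprD _ 3 2) z3 z2 mulN1r opprB subr_eq -subr_eq0 opprD addrA subrr sub0r.
  by rewrite oppr_eq0 zeta6_neq0.
Qed.

Lemma has_orderX (A : unitRingType) (x : A) n d : has_order x (n * d) ->
  has_order (x ^+ d) n.
Proof.
move=> ox; case: (ox) => nd0 xnd _; have := nd0; rewrite muln_gt0 => /andP[n0 d0].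
apply: has_orderI => // [|m]; first by rewrite -exprM mulnC.
by rewrite -exprM => /(expr_has_order ox); rewrite mulnC dvdn_pmul2l.
Qed.

Lemma cis_5pi6 : cis (5 * pi / 6) = zeta12 ^+ 5.
Proof. by rewrite -cisMn; congr cis; field. Qed.
Lemma cis_2pi3 : cis (2 * pi / 3) = zeta6 ^+ 2.
Proof. by rewrite -cisMn; congr cis; field. Qed.
Lemma cis_Npi3 : cis (- (pi / 3)) = zeta6^-1.
Proof. by apply: (mulIf (@zeta6_neq0 K)); rewrite cisN mulVf ?zeta6_neq0. Qed.

Lemma zeta12_trace : zeta12 + zeta12 ^+ 5 = 0 +i* 1.
Proof.
rewrite -zeta12_cube; have z := zeta12_sqr (K := K); have z2 := @zeta6_sqr K.
have -> : zeta12 ^+ 5 = zeta12 * (zeta12 ^+ 2) ^+ 2 by ring.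
by rewrite z z2 [zeta12 ^+ 3]exprSr z; ring.
Qed.

Lemma zeta12_det : zeta12 * zeta12 ^+ 5 = -1.
Proof. by rewrite -exprS (exprM _ 2 3) zeta12_sqr zeta6_cube. Qed.

(** The determinant kills <g>, so the order of h modulo <g> is at least, hence
    exactly, that of its determinant. *)
Lemma extension_of_det k e g h : \tr g = 1 -> \det g = 1 ->
  h * g = g ^+ e * h -> has_order (\det h) k -> cyclic_gen g (h ^+ k) ->
  cyclic_extension 6 k e g h.
Proof.
move=> tg dg hg dh hk; case: (dh) => k0 _ _; have og := tr1_has_order6 tg dg.
case: (og) => g60 g6 _; split=> // j.
rewrite (cyclic_gen_torsion g60 g6) => -[i _ E].
by apply: (expr_has_order dh); rewrite -det2X -E det2X dg expr1n.
Qed.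

Section Setting.
Variables (k e : nat) (g h : 'M[C]_2).
Hypotheses (dg : \det g = 1) (dh : has_order (\det h) k).
Hypothesis ext : cyclic_extension 6 k e g h.

Lemma extension_SL2 x : Defs.generated [set g; h] x -> \det x = 1 -> cyclic_gen g x.
Proof.
have [[g60 g6 _] _ k0 hk _] := ext.
rewrite (metacyclic_generated ext) => -[i _ [j _ <-]].
rewrite det2M !det2X dg expr1n mul1r => /(expr_has_order dh)/dvdnP[q ->].
move: hk; rewrite (cyclic_gen_torsion g60 g6) => -[m _ mE].
by exists (i + m * q)%N => //; rewrite [(q * k)%N]mulnC exprM -mE -exprM exprD.
Qed.

Lemma extension_C6_setting R : is_subring R -> GL2 R g -> GL2 R h ->
  C6_setting R (Defs.generated [set g; h]) g h.
Proof.
move=> Rs Rg Rh; have [[g60 g6 gm] _ k0 hk _] := ext.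
have [d0 dk _] := dh.
have GL : Defs.generated [set g; h] `<=` GL2 R.
  by apply: generated_sub; [exact: GL2_subgroup | move=> x [->|->]].
split.
- split=> //; last exact: metacyclic_finite ext.
  by rewrite (metacyclic_generated ext); exact: metacyclic_subgroup ext.
- apply/seteqP; split=> [x [Mx [_ dx]]|x]; first exact: extension_SL2.
  rewrite (cyclic_gen_torsion g60 g6) => -[i _ <-].
  have Mi : Defs.generated [set g; h] (g ^+ i).
    rewrite (metacyclic_generated ext); exists i => //; exists 0%N => //.
    by rewrite expr0 mulr1.
  by split=> //; split; [exact: GL | rewrite det2X dg expr1n].
- exact: has_order_isomorphic.
- by move=> M [_ SM]; apply: SM; right.
- rewrite (cyclic_gen_torsion d0 dk) (metacyclic_generated ext).
  apply/seteqP; split=> [_ [_ [i _ [j _ <-]] <-]|_ [j _ <-]].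
    by exists j => //; rewrite det2M !det2X dg expr1n mul1r.
  exists (h ^+ j); last exact: det2X.
  by exists 0%N => //; exists j => //; rewrite expr0 mul1r.
Qed.

(** If the determinant of x is that of h^j, then x h^-j lies in SL(2), hence
    in <g>. *)
Lemma extension_unique (R : set C) (H : set 'M[C]_2) : is_subgroup H ->
  H `<=` GL2 R -> H `&` SL2 R = cyclic_gen g -> H h ->
  determinant @` H = cyclic_gen (\det h) -> H = Defs.generated [set g; h].
Proof.
move=> Hs HR HS Hh Hd; have [[g60 g6 gm] _ k0 hk _] := ext.
have [d0 dk _] := dh; have [HU H1 HM HV] := Hs.
have Hg : H g.
  have : (H `&` SL2 R) g by rewrite HS; exact: (@cyclic_genX _ g 1).
  by case.
have HX x n : H x -> H (x ^+ n).
  by move=> Hx; elim: n => [|n IH]; rewrite ?expr0 // exprS; exact: HM.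
apply/seteqP; split; last by apply: generated_sub => // x [->|->].
move=> x Hx; have : cyclic_gen (\det h) (\det x) by rewrite -Hd; exists x.
rewrite (cyclic_gen_torsion d0 dk) => -[j _ dx].
have hjU : h ^+ j \is a GRing.unit by apply: HU; exact: HX.
have xh : cyclic_gen g (x * (h ^+ j)^-1).
  rewrite -HS; have Hxh : H (x * (h ^+ j)^-1) by apply: HM => //; apply: HV; exact: HX.
  split=> //; split; first exact: HR.
  rewrite det2M det2V det2X dx divff //.
  by move: hjU; rewrite unit2E det2X dx.
move: xh; rewrite (cyclic_gen_torsion g60 g6) => -[i _ E].
rewrite (metacyclic_generated ext); exists i => //; exists j => //.
by rewrite E divrK.
Qed.

End Setting.

(** As h^2 = g, the group is generated by h alone. *)
Lemma HC6_1 g h : \tr g = 1 -> \det g = 1 -> h ^+ 2 = g -> \det h = -1 ->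
  \tr h = 0 +i* 1 ->
  cyclic_extension 6 2 1 g h ->
  HC6 1 gaussian_integers (Defs.generated [set g; h]) g h.
Proof.
move=> tg dg h2 dh th ext; have og := tr1_has_order6 tg dg.
have [_ g6 _] := og.
have oh : has_order h 12.
  apply: has_orderI; [by [] | by rewrite (exprM h 2 6) h2 | move=> m hm].
  have /(expr_has_order has_orderN1)/dvdnP[q mE] : (-1 : C) ^+ m = 1.
    by rewrite -dh -det2X hm det1.
  move: hm; rewrite mE mulnC exprM h2 => /(expr_has_order og).
  by rewrite -[12%N]/(2 * 6)%N dvdn_pmul2l.
have [h0 h12 _] := oh.
have genE : Defs.generated [set g; h] = cyclic_gen h.
  rewrite (metacyclic_generated ext) (cyclic_gen_torsion h0 h12).
  apply/seteqP; split=> [_ [i _ [j _ <-]]|_ [j _ <-]].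
    by exists (2 * i + j)%N => //; rewrite exprD exprM h2.
  by exists 0%N => //; exists j => //; rewrite expr0 mul1r.
split=> //; first by rewrite genE; exact: has_order_isomorphic.
apply: eigenvalues2; first by rewrite th cis_5pi6 zeta12_trace.
by rewrite dh cis_5pi6 zeta12_det.
Qed.

Lemma HC6_2 R g h : \tr h = 0 -> \det h = -1 -> h ^+ 2 = 1 ->
  R = ring_of_integers 3 \/ R = quad_order 3 2 ->
  cyclic_extension 6 2 1 g h ->
  HC6 2 R (Defs.generated [set g; h]) g h.
Proof.
move=> th dh h2 RE ext; split=> //.
- exact: metacyclic_dprod ext h2.
- exact: (@metacyclic_dprod_isomorphic _ _ _ 6 2).
- by apply: eigenvalues2; rewrite ?th ?addNr ?dh ?mulr1.
Qed.

Lemma scalar2X (c : C) n : (c%:M : 'M[C]_2) ^+ n = (c ^+ n)%:M.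
Proof. by rewrite -rmorphXn. Qed.

Lemma inv_relation e g h : h \is a GRing.unit -> h * g = g ^+ e * h ->
  h * g * h^-1 = g ^+ e.
Proof. by move=> hU ->; rewrite mulrK. Qed.

Lemma HC6_3 R g h : \tr g = 1 -> \det g = 1 -> \tr h = 0 -> \det h = -1 ->
  h ^+ 2 = 1 -> cyclic_extension 6 2 5 g h ->
  HC6 3 R (Defs.generated [set g; h]) g h.
Proof.
move=> tg dg th dh h2 ext; have [_ hg _ _ _] := ext; split=> //.
- split=> //; first exact: tr1_cube.
  rewrite (inv_relation (metacyclic_h_unit ext) hg).
  by rewrite tr1_pow5 // tr1_inv.
- exact: metacyclic_presented3.
- exact: metacyclic_dihedral.
- by apply: eigenvalues2; rewrite ?th ?addNr ?dh ?mulr1.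
Qed.

Lemma HC6_4 g h : \tr g = 1 -> h = (zeta6 ^+ 2)%:M -> h ^+ 3 = 1 ->
  cyclic_extension 6 3 1 g h ->
  HC6 4 (ring_of_integers 3) (Defs.generated [set g; h]) g h.
Proof.
move=> tg hE h3 ext; split=> //.
- exact: metacyclic_dprod ext h3.
- by rewrite cis_2pi3.
- exact: (@metacyclic_dprod_isomorphic _ _ _ 6 3).
Qed.

(** Cayley-Hamilton gives h^2 = -i. The two eigenvalues are opposite, since 3
    pi / 4 and - pi / 4 differ by pi. *)
Lemma HC6_5 g h : \tr g = 1 -> \det g = 1 -> \tr h = 0 -> \det h = 0 +i* 1 ->
  cyclic_extension 6 4 5 g h ->
  HC6 5 gaussian_integers (Defs.generated [set g; h]) g h.
Proof.
move=> tg dg th dh ext; have [_ hg _ _ _] := ext.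
have h4 : h ^+ 4 = -1.
  rewrite (exprM h 2 2) (Cayley_Hamilton2 h) th dh scale0r sub0r sqrrN.
  by rewrite scalar2X imaginary_sqr raddfN.
split=> //.
- split=> //; first exact: tr1_cube.
  rewrite (inv_relation (metacyclic_h_unit ext) hg).
  by rewrite tr1_pow5 // tr1_inv.
- split; last exact: (metacyclic_card ext).
  by apply: metacyclic_presented5 => //; rewrite tr1_cube.
have E : cis (3 * pi / 4) = - cis (- (pi / 4)) :> C.
  by rewrite -mulN1r -cis_pi -cisD; congr cis; field.
apply: eigenvalues2; first by rewrite th E addNr.
by rewrite dh -cis_pihalf -cisD; congr cis; field.
Qed.

(** Cayley-Hamilton gives h^2 = - zeta6, hence h^6 = - zeta6^3 = 1. *)
Lemma HC6_6 g h : \tr g = 1 -> \det g = 1 -> \tr h = 0 -> \det h = zeta6 ->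
  cyclic_extension 6 6 5 g h ->
  HC6 6 (ring_of_integers 3) (Defs.generated [set g; h]) g h.
Proof.
move=> tg dg th dh ext; have [_ hg _ _ _] := ext.
have h6 : h ^+ 6 = 1.
  rewrite (exprM h 2 3) (Cayley_Hamilton2 h) th dh scale0r sub0r.
  by rewrite -raddfN scalar2X -[- zeta6]mulN1r exprMn zeta6_cube -signr_odd mulN1r opprK.
split=> //.
- split=> //; first exact: tr1_cube.
  rewrite (inv_relation (metacyclic_h_unit ext) hg).
  by rewrite tr1_pow5 // tr1_inv.
- split; last exact: (metacyclic_card ext).
  exact: metacyclic_presented6.
have z2 := @zeta6_sqr K; apply: eigenvalues2; rewrite cis_2pi3 cis_Npi3.
  by rewrite th zeta6_inv z2; ring.
by rewrite dh expr2 mulfK ?zeta6_neq0.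
Qed.

Lemma HC6_7 g h : \tr h = zeta6 ^+ 2 + zeta6^-1 -> \det h = zeta6 ->
  h ^+ 6 = 1 -> cyclic_extension 6 6 1 g h ->
  HC6 7 (ring_of_integers 3) (Defs.generated [set g; h]) g h.
Proof.
move=> th dh h6 ext; split=> //.
- exact: metacyclic_dprod ext h6.
- split; last exact: (metacyclic_card ext).
  exact: (@metacyclic_dprod_isomorphic _ _ _ 6 6).
apply: eigenvalues2; rewrite cis_2pi3 cis_Npi3 //.
by rewrite dh expr2 mulfK ?zeta6_neq0.
Qed.

End Extensions.

(** * The classification *)

Section UnitsOfOrders.
Context {K : realType}.
Local Notation C := K[i].
Local Notation zeta6 := (@zeta6 K).
Local Notation theta := (sqrtN 3 : C).
Implicit Types (R : set C).

(** Representatives of the nontrivial roots of unity of imaginary quadratic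
    orders up to inversion: those with a nonnegative imaginary part. *)
Definition normalized_det (u : C) : Prop :=
  [\/ u = -1, u = 0 +i* 1, u = zeta6 | u = zeta6 ^+ 2].

(** The integral norms of a unit and of its inverse have product 1. *)
Lemma unit_sqnorm R u : is_order R -> units_in R u -> sqnorm u = 1.
Proof.
move=> [_ Ro] [Ru [v Rv uv]].
have [_ [n [_ nE]]] := Ro _ Ru; have [_ [m [_ mE]]] := Ro _ Rv.
have := sqnormM u v; rewrite uv sqnorm1 nE mE -rmorphM /= => /esym/eqP.
rewrite -[1]/(1%:~R) eqr_int => /eqP nm.
have n0 : 0 <= n by rewrite -(ler_int K) -nE sqnorm_ge0.
have /eqP := congr1 absz nm; rewrite abszM muln_eq1 => /andP[/eqP n1 _].
by have -> : n = 1 by lia.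
Qed.

(** On the unit circle the integer 2 Re u lies between -2 and 2, and it
    determines u in the closed upper half plane. *)
Lemma unit_normalized (u : C) (m : int) : sqnorm u = 1 -> Re u *+ 2 = m%:~R ->
  0 <= Im u -> u = 1 \/ normalized_det u.
Proof.
have s3 := @sqrt3_sqr K; have s0 := @sqrt3_gt0 K; have z2 := @zeta6_sqr K.
move=> u1 uE ui.
have h3 : (sqrt3 / 2) ^+ 2 = 3 / 4 :> K by rewrite exprMn s3; field.
have mm : m * m <= 4.
  rewrite -(ler_int K) rmorphM /= -uE.
  have : 0 <= Im u ^+ 2 by exact: sqr_ge0.
  by move: u1; rewrite /sqnorm; lra.
have RE : Re u = m%:~R / 2 by rewrite -uE; field.
have IE : Im u ^+ 2 = 1 - (m%:~R / 2) ^+ 2 by rewrite -RE -u1 /sqnorm addrAC subrr add0r.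
have ImE (c : K) : 0 <= c -> Im u ^+ 2 = c ^+ 2 -> Im u = c.
  by move=> c0 /eqP; rewrite eqrXn2 // => /eqP.
have [mE|[mE|[mE|[mE|mE]]]] : m = -2 \/ m = -1 \/ m = 0 \/ m = 1 \/ m = 2 by nia.
- right; constructor 1; apply: cxP; rewrite !cxE ?RE ?mE; first by field.
  by rewrite oppr0; apply: ImE => //; rewrite IE mE; field.
- right; constructor 4; rewrite z2; apply: cxP; rewrite zeta6E !cxE /= ?RE ?mE.
    by field.
  rewrite subr0; apply: ImE; first by lra.
  by rewrite IE mE h3; field.
- right; constructor 2; apply: cxP; rewrite /= ?RE ?mE; first by field.
  by apply: ImE => //; rewrite IE mE; field.
- right; constructor 3; apply: cxP; rewrite zeta6E /= ?RE ?mE; first by field.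
  apply: ImE; first by lra.
  by rewrite IE mE h3; field.
- left; apply: cxP; rewrite !cxE ?RE ?mE; first by field.
  by apply: ImE => //; rewrite IE mE; field.
Qed.

Lemma unit_or_inv_normalized R u : is_order R -> units_in R u ->
  [\/ u = 1, normalized_det u | normalized_det u^-1].
Proof.
move=> Ro Ru; have u1 := unit_sqnorm Ro Ru.
have [m [_ [mE _]]] := Ro.2 _ Ru.1.
have [ui|ui] := leP 0 (Im u).
  by case: (unit_normalized u1 mE ui) => ?; [constructor 1|constructor 2].
rewrite -(conj_inv_unit u1).
have [|||E|?] := @unit_normalized u^*%C m.
- by move: u1; rewrite /sqnorm; case: (u) => a b /=; rewrite sqrrN.
- by rewrite -mE; case: (u).
- by move: ui; case: (u) => a b /=; rewrite oppr_ge0 => /ltW.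
- by constructor 1; rewrite -(conjcK u) E conjc1.
- by constructor 3.
Qed.

Lemma normalized_det_order u : normalized_det u ->
  exists2 k, (1 < k)%N & has_order u k.
Proof.
case=> ->; [exists 2 | exists 4 | exists 6 | exists 3] => //.
- exact: has_orderN1.
- exact: has_order_imaginary.
- exact: has_order_zeta6.
- exact: (@has_orderX _ _ 3 2) has_order_zeta6.
Qed.

Lemma cyclic_gen_inv (A : unitRingType) (x : A) : cyclic_gen x^-1 = cyclic_gen x.
Proof.
apply/seteqP; split=> _ [n _ <-]; exists (- n) => //.
  by rewrite exprz_inv.
by rewrite exprz_inv opprK.
Qed.

Lemma has_orderV (A : unitRingType) (x : A) n : has_order x n -> has_order x^-1 n.
Proof.
case=> n0 xn xm; split=> // [|m mn]; first by rewrite exprVn xn invr1.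
by rewrite exprVn -(inj_eq invr_inj) invrK invr1 xm.
Qed.

Lemma norm3_solutions (a b : int) : a * a + a * b + b * b = 3 ->
  [\/ (a = 1 /\ b = 1) \/ (a = -1 /\ b = -1),
      (a = 2 /\ b = -1) \/ (a = -2 /\ b = 1)
    | (a = 1 /\ b = -2) \/ (a = -1 /\ b = 2)].
Proof.
move=> E; have a2 : `|a| <= 2 by nia.
have b2 : `|b| <= 2 by nia.
have [aE|[aE|[aE|[aE|aE]]]] : a = -2 \/ a = -1 \/ a = 0 \/ a = 1 \/ a = 2 by lia.
all: have [bE|[bE|[bE|[bE|bE]]]] : b = -2 \/ b = -1 \/ b = 0 \/ b = 1 \/ b = 2 by lia.
all: move: E; rewrite aE bE //= => _.
all: first [by constructor 1; tauto | by constructor 2; tauto | by constructor 3; tauto].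
Qed.

(** The prime 3 is ramified: it is - sqrt(-3)^2, so the elements of norm 3 are
    the six associates of sqrt(-3). *)
Lemma eisenstein_norm3 (x : C) : eisenstein x -> sqnorm x = 3 ->
  exists k, x = theta * zeta6 ^+ k.
Proof.
have z2 := @zeta6_sqr K; have z3 := @zeta6_cube K.
move=> [a _ [b _ <-]]; rewrite sqnorm_eis => /eqP.
rewrite -[3]/(3%:~R) eqr_int => /eqP E.
have := norm3_solutions E.
move=> sol.
have z5 : zeta6 ^+ 5 = 1 - zeta6 by rewrite (exprD _ 3 2) z3 z2; ring.
have z4 : zeta6 ^+ 4 = - zeta6 by rewrite exprS z3; ring.
case: sol => [[] [-> ->]|[] [-> ->]|[] [-> ->]].
- exists 5%N; rewrite theta_zeta6 z5.
  transitivity (-2 * (zeta6 ^+ 2) + 3 * zeta6 - 1); last by ring.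
  by rewrite z2; ring.
- exists 2%N; rewrite theta_zeta6 z2.
  transitivity (2 * (zeta6 ^+ 2) - 3 * zeta6 + 1); last by ring.
  by rewrite z2; ring.
- exists 4%N; rewrite theta_zeta6 z4.
  transitivity (-2 * (zeta6 ^+ 2) + zeta6); last by ring.
  by rewrite z2; ring.
- exists 1%N; rewrite theta_zeta6 expr1.
  transitivity (2 * (zeta6 ^+ 2) - zeta6); last by ring.
  by rewrite z2; ring.
- exists 3%N; rewrite theta_zeta6 z3; ring.
- exists 0%N; rewrite theta_zeta6 expr0; ring.
Qed.

End UnitsOfOrders.

Section Classification.
Context {K : realType}.
Local Notation C := K[i].
Local Notation zeta6 := (@zeta6 K).
Local Notation zeta12 := (@zeta12 K).
Local Notation theta := (sqrtN 3 : C).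
Variables (R : set C) (H : set 'M[C]_2) (g : 'M[C]_2).
Hypothesis Ro : is_order R.
Hypothesis Hfs : finite_subgroup H (GL2 R).
Hypothesis HS : H `&` SL2 R = cyclic_gen g.
Hypothesis isog : isomorphic (cyclic_gen g) (Zp 6).

Let Rs : is_subring R. Proof. by case: Ro. Qed.
Let Hs : is_subgroup H. Proof. by case: Hfs. Qed.
Let HR : H `<=` GL2 R. Proof. by case: Hfs. Qed.
Let og : has_order g 6. Proof. exact: isomorphic_has_order isog. Qed.
Let HSg : (H `&` SL2 R) g. Proof. by rewrite HS; exact: (@cyclic_genX _ g 1). Qed.
Let Hg : H g. Proof. by case: HSg. Qed.
Let dg : \det g = 1. Proof. by case: HSg => _ []. Qed.
Let tg : \tr g = 1. Proof. exact: order6_trace. Qed.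

Let HM x y : H x -> H y -> H (x * y). Proof. by case: Hs => _ _ + _; apply. Qed.
Let HV x : H x -> H x^-1. Proof. by case: Hs => _ _ _; apply. Qed.
Let H1 : H 1. Proof. by case: Hs. Qed.
Let HU x : H x -> x \is a GRing.unit. Proof. by case: Hs => + _ _ _; apply. Qed.
Let HX x n : H x -> H (x ^+ n).
Proof. by move=> Hx; elim: n => [|n IH]; rewrite ?expr0 // exprS; exact: HM. Qed.

Let H_SL x : H x -> \det x = 1 -> cyclic_gen g x.
Proof. by move=> Hx dx; rewrite -HS; split=> //; split=> //; exact: HR. Qed.

Let cg : cyclic_gen g = [set g ^+ i | i in [set: nat]].
Proof. by case: og => g60 g6 _; exact: cyclic_gen_torsion g60 g6. Qed.

(** The conjugate of g is a power g^j of trace 1, and among the powers of g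
    only g and g^5 have trace 1. *)
Lemma normalizes_cases h : H h -> h * g = g ^+ 1 * h \/ h * g = g ^+ 5 * h.
Proof.
move=> Hh; have hU := HU Hh.
have dh0 : \det h != 0 by rewrite -unit2E.
have : cyclic_gen g (h * g * h^-1).
  apply: H_SL; first by apply: HM; [exact: HM | exact: HV].
  by rewrite !det2M det2V dg mulr1 divff.
rewrite cg => -[i _]; rewrite -(@expr_mod _ 6 g i); last by case: og.
have : (i %% 6 < 6)%N by rewrite ltn_mod.
move: (i %% 6)%N => j j6 E.
have tE : \tr (g ^+ j) = 1.
  by rewrite E -[_ * h^-1]/(_ *m _) mxtrace_mulC -[_ *m _]/(_ * _) mulrA mulVr // mul1r.
have hg : h * g = g ^+ j * h by rewrite E mulrVK.
case: j j6 E tE hg => [|[|[|[|[|[|j]]]]]] // _ _ tE hg; [| by left | | | | by right].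
all: exfalso; move: tE.
- rewrite expr0 mxtrace1 => /(congr1 (@complex.Re K)); rewrite !cxE; lra.
- rewrite tr1_sqr // raddfB /= mxtrace1 tg => /(congr1 (@complex.Re K)).
  by rewrite !cxE; lra.
- rewrite tr1_cube // raddfN /= mxtrace1 => /(congr1 (@complex.Re K)).
  by rewrite !cxE; lra.
- rewrite (exprD g 3 1) tr1_cube // expr1 mulN1r raddfN /= tg.
  by move=> /(congr1 (@complex.Re K)); rewrite !cxE; lra.
Qed.

(** Let T = tr(h) and S = tr(gh). The relation h g = (1 - g) h gives S = T -
    S, and also g h g = h, whence T = tr(g^2 h) = S - T. *)
Lemma inverted_trace h : h * g = g ^+ 5 * h -> \tr h = 0.
Proof.
rewrite tr1_pow5 // mulrBl mul1r => hg.
have trC x y : \tr (x * y) = \tr (y * x) :> C by exact: mxtrace_mulC.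
have E1 : \tr (g * h) = \tr h - \tr (g * h).
  by rewrite -[LHS]trC hg raddfB.
have ghg : g * h * g = h.
  rewrite -mulrA hg mulrBr mulrA -expr2 tr1_sqr // mulrBl mul1r opprB addrCA.
  by rewrite subrr addr0.
have E2 : \tr h = \tr (g * h) - \tr h.
  by rewrite -[in LHS]ghg trC mulrA -expr2 tr1_sqr // mulrBl mul1r raddfB.
have E3 : 3 * \tr h = 0.
  transitivity (2 * (\tr h - (\tr (g * h) - \tr h))
                + (\tr (g * h) - (\tr h - \tr (g * h)))).
    by ring.
  by rewrite -E1 -E2 !subrr mulr0 addr0.
by move/eqP: E3; rewrite mulf_eq0 pnatr_eq0 => /eqP.
Qed.

(** Reduces the classification to exhibiting a suitable h in H. *)
Lemma HC6_of_extension i k e h :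
  (cyclic_extension 6 k e g h -> HC6 i R (Defs.generated [set g; h]) g h) ->
  H h -> determinant @` H = cyclic_gen (\det h) -> has_order (\det h) k ->
  h * g = g ^+ e * h -> (1 <= i <= 7)%N ->
  exists (i : nat) (h : 'M[C]_2),
    [/\ (1 <= i <= 7)%N, C6_setting R H g h & HC6 i R H g h].
Proof.
move=> Hi Hh Hd dh hg i17.
have ext : cyclic_extension 6 k e g h.
  apply: extension_of_det => //; apply: H_SL; first exact: HX.
  by rewrite det2X; case: dh.
have HE := extension_unique dh ext Hs HR HS Hh Hd.
by exists i, h; split=> //; rewrite HE; exact: Hi.
Qed.

Let dnz h : H h -> \det h != 0. Proof. by move=> /HU; rewrite unit2E. Qed.

(** In the case det(h) = zeta6^2 of order 3, h^3 = - det(h) h has determinant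
    1 and so is a power of g. Then h would commute with g. *)
Lemma classify_inverting h : H h -> determinant @` H = cyclic_gen (\det h) ->
  normalized_det (\det h) -> h * g = g ^+ 5 * h ->
  exists (i : nat) (h : 'M[C]_2),
    [/\ (1 <= i <= 7)%N, C6_setting R H g h & HC6 i R H g h].
Proof.
move=> Hh Hd nd hg; have th := inverted_trace hg.
have h2 : h ^+ 2 = - (\det h)%:M by rewrite Cayley_Hamilton2 th scale0r sub0r.
have Rd : R (\det h) by case: (HR Hh) => _ [].
case: nd => dE.
- apply: (HC6_of_extension (i := 3) (k := 2) (e := 5) _ Hh) => //.
    by apply: HC6_3 => //; rewrite h2 dE raddfN opprK.
  by rewrite dE; exact: has_orderN1.
- apply: (HC6_of_extension (i := 5) (k := 4) (e := 5) _ Hh) => //.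
    move=> ext; rewrite (gaussian_of_i Ro); last by rewrite -dE.
    exact: HC6_5.
  by rewrite dE; exact: has_order_imaginary.
- apply: (HC6_of_extension (i := 6) (k := 6) (e := 5) _ Hh) => //.
    move=> ext; rewrite (eisenstein_of_zeta6 Ro); last by rewrite -dE.
    by rewrite -ring_of_integers3; exact: HC6_6.
  by rewrite dE; exact: has_order_zeta6.
- exfalso; have d3 : (\det h) ^+ 3 = 1.
    by rewrite dE -exprM; case: (@has_order_zeta6 K).
  have h3 : h ^+ 3 = - (\det h) *: h.
    by rewrite exprS h2 mulrN scaleNr -mul_mx_scalar.
  have : cyclic_gen g (h ^+ 3) by apply: H_SL; [exact: HX | rewrite det2X].
  rewrite cg => -[i _ gi].
  have comm : h * g = g * h.
    have E : h ^+ 3 * g = g * h ^+ 3 by rewrite -gi -exprSr -exprS.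
    move: E; rewrite h3 -scalerAl -scalerAr.
    by apply: scalerI; rewrite oppr_eq0 dnz.
  have E : g = g ^+ 5.
    by apply: (mulIr (HU Hh)); rewrite -hg comm.
  by have := has_order_inj (i := 1) (j := 5) og isT isT E.
Qed.

(** The eigenvalues of h lie on the unit circle because h has finite order. *)
Lemma commuting_parts h : H h -> normalized_det (\det h) -> h * g = g ^+ 1 * h ->
  exists l1 l2, [/\ h = eigen_mx g l1 l2, \det h = l1 * l2,
    sqnorm l1 = 1, sqnorm l2 = 1 & R (l1 + l2) /\ R (zeta6 * l1 + zeta6^-1 * l2)].
Proof.
rewrite expr1 => Hh /normalized_det_order[k k1 dh] hg; have [l1 [l2 hE]] := centralizer_eigen_mx tg dg hg.
have RT x : H x -> R (\tr x).
  by move=> /HR[Rx _]; rewrite tr2E; exact: (srD Rs).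
have [N N0 hN] : exists2 N, (0 < N)%N & h ^+ N = 1.
  have : cyclic_gen g (h ^+ k).
    by apply: H_SL; [exact: HX | rewrite det2X; case: dh].
  rewrite cg => -[i _ gi]; exists (k * 6)%N; first by rewrite muln_gt0 ltnW.
  by rewrite exprM -gi -exprM mulnC exprM; case: og => _ -> _; rewrite expr1n.
have := hN; rewrite hE eigen_mxX // -[1](eigen_mx_scalar g 1).
move/(eigen_mx_inj tg dg) => [n1 n2].
exists l1, l2; split=> //.
- exact: eigen_mx_det.
- exact: sqnorm_root n1.
- exact: sqnorm_root n2.
- split; first by rewrite -(eigen_mx_tr tg) -hE; exact: RT.
  rewrite -(eigen_mx_tr tg) -(eigen_mxM tg dg) (eigen_mx_g g) -hE.
  by apply: RT; exact: HM.
Qed.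

Let powg m : g ^+ m = eigen_mx g (zeta6 ^+ m) (zeta6^-1 ^+ m).
Proof. by rewrite -(eigen_mxX tg dg) (eigen_mx_g g). Qed.

Let z0 := @zeta6_neq0 K.
Let z6 : zeta6 ^+ 6 = 1. Proof. by case: (@has_order_zeta6 K). Qed.
Let zV : zeta6^-1 = zeta6 ^+ 5.
Proof. by apply: (mulfI z0); rewrite divff // -exprS z6. Qed.

Let twist h m : H h -> determinant @` H = cyclic_gen (\det h) ->
  h * g = g ^+ 1 * h ->
  [/\ H (h * g ^+ m), \det (h * g ^+ m) = \det h,
      determinant @` H = cyclic_gen (\det (h * g ^+ m))
    & h * g ^+ m * g = g ^+ 1 * (h * g ^+ m)].
Proof.
move=> Hh Hd hg; have dE : \det (h * g ^+ m) = \det h.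
  by rewrite det2M det2X dg expr1n mulr1.
split=> //; [by apply: HM => //; exact: HX | by rewrite dE | ].
by rewrite mulrA -hg -!mulrA -exprSr exprS.
Qed.

(** Let h^2 = g^i. Multiplying h by a power of g changes l1^2 by an even power
    of zeta6, so l1 can be normalized to a square root of 1 or of zeta6,
    according to the parity of i. *)
Lemma classify_commuting_N1 h : H h -> determinant @` H = cyclic_gen (\det h) ->
  \det h = -1 -> h * g = g ^+ 1 * h ->
  exists (i : nat) (h : 'M[C]_2),
    [/\ (1 <= i <= 7)%N, C6_setting R H g h & HC6 i R H g h].
Proof.
move=> Hh Hd dh hg.
have [|l1 [l2 [hE dE _ _ _]]] := commuting_parts Hh _ hg; first by constructor 1.
have : cyclic_gen g (h ^+ 2).
  by apply: H_SL; [exact: HX | rewrite det2X dh sqrrN expr1n].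
rewrite cg => -[i _]; rewrite powg hE eigen_mxX // => /(eigen_mx_inj tg dg)[l1E _].
have l2E : l2 = - l1^-1.
  have l10 : l1 != 0.
    by apply/eqP => l10; move/eqP: dE; rewrite l10 mul0r dh oppr_eq0 oner_eq0.
  by apply: (mulfI l10); rewrite -dE dh mulrN divff.
have tw m : h * g ^+ m = eigen_mx g (l1 * zeta6 ^+ m) (- (l1 * zeta6 ^+ m)^-1).
  by rewrite hE powg eigen_mxM // l2E mulNr exprVn invfM.
have sq m : (l1 * zeta6 ^+ m) ^+ 2 = zeta6 ^+ (i + m * 2).
  by rewrite exprMn -l1E -exprM exprD.
have [j iE] : exists j, i = (j * 2)%N \/ i = (j * 2).+1.
  by exists (i %/ 2)%N; lia.
case: iE => iE.
(* zeta6 ^+ (j * 5) is zeta6 ^- j *)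
- have l1s : (l1 * zeta6 ^+ (j * 5)) ^+ 2 = 1.
    by rewrite sq iE (_ : (_ + _ = 6 * (2 * j))%N) ?exprM ?z6 ?expr1n //; lia.
  have [Hh' dh' Hd' hg'] := twist (j * 5) Hh Hd hg.
  rewrite tw in Hh' dh' Hd' hg'.
  set l := l1 * _ in l1s Hh' dh' Hd' hg'.
  have lV : - l^-1 = - l.
    congr (- _); have l0 : l != 0.
      by rewrite -sqrf_eq0 l1s oner_eq0.
    by apply: (mulfI l0); rewrite divff // -l1s expr2.
  rewrite lV in Hh' dh' Hd' hg'.
  apply: (HC6_of_extension (i := 2) (k := 2) (e := 1) _ Hh' Hd' _ hg' isT); last first.
    by rewrite dh' dh; exact: has_orderN1.
  move=> ext; apply: HC6_2 => //.
  + by rewrite eigen_mx_tr // subrr.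
  + by rewrite dh'.
  + by rewrite eigen_mxX // sqrrN l1s eigen_mx_scalar.
  rewrite quad_order32 ring_of_integers3; apply: order_of_theta => //.
  have [|m1 [m2 [E _ _ _ [_ RT]]]] := commuting_parts Hh' _ hg'.
    by constructor 1; rewrite dh'.
  have [m1E m2E] := eigen_mx_inj tg dg E.
  move: RT; rewrite -m1E -m2E mulrN -mulrBl zeta6_inv.
  rewrite (_ : zeta6 - (1 - zeta6) = theta); last by rewrite theta_zeta6; ring.
  have /orP[/eqP->|/eqP->] : (l == 1) || (l == -1) by rewrite -sqrf_eq1 l1s.
    by rewrite mulr1.
  by rewrite mulrN1 => /(srN Rs); rewrite opprK.
(* the factor zeta6 ^+ (m * 3) is a sign, which selects zeta12 among the two roots *)
- have l1s m : (l1 * zeta6 ^+ (j * 5 + m * 3)) ^+ 2 = zeta12 ^+ 2.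
    rewrite sq iE zeta12_sqr (_ : (_ + _ = 6 * (2 * j + m) + 1)%N); last by lia.
    by rewrite exprD exprM z6 expr1n mul1r expr1.
  have [m lE] : exists m, l1 * zeta6 ^+ (j * 5 + m * 3) = zeta12.
    have := l1s 0%N; move/eqP; rewrite eqf_sqr mul0n addn0 => /orP[/eqP E|/eqP E].
      by exists 0%N; rewrite mul0n addn0.
    by exists 1%N; rewrite exprD mulrA E mul1n zeta6_cube mulrN1 opprK.
  have [Hh' dh' Hd' hg'] := twist (j * 5 + m * 3) Hh Hd hg.
  have z12V : - zeta12^-1 = zeta12 ^+ 5.
    have z120 : zeta12 != 0 by rewrite -sqrf_eq0 zeta12_sqr.
    by apply: (mulfI z120); rewrite mulrN divff // zeta12_det.
  rewrite tw lE z12V in Hh' dh' Hd' hg'.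
  set h' := eigen_mx g _ _ in Hh' dh' Hd' hg'.
  have th' : \tr h' = 0 +i* 1 by rewrite eigen_mx_tr // zeta12_trace.
  have Ri : R (0 +i* 1).
    by rewrite -th' tr2E; case: (HR Hh') => Rh' _; exact: (srD Rs).
  apply: (HC6_of_extension (i := 1) (k := 2) (e := 1) _ Hh' Hd' _ hg' isT); last first.
    by rewrite dh' dh; exact: has_orderN1.
  move=> ext; rewrite (gaussian_of_i Ro Ri); apply: HC6_1 => //.
    rewrite eigen_mxX // -exprM zeta12_sqr (_ : zeta12 ^+ (5 * 2) = zeta6^-1).
      exact: eigen_mx_g.
    by rewrite zV -zeta12_sqr -exprM.
  by rewrite dh'.
Qed.

(** For m1 and m2 on the unit circle with product i, the sum s = m1 + m2
    satisfies s = i times its conjugate, so a Gaussian s is an integral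
    multiple of 1 + i. This applies to the traces of h and gh, and the trace
    of g^2 h is their difference. *)
Lemma no_commuting_imaginary h : H h -> h * g = g ^+ 1 * h -> \det h <> 0 +i* 1.
Proof.
move=> Hh hg dh.
have [|l1 [l2 [hE dE n1 n2 [RT0 RT1]]]] := commuting_parts Hh _ hg.
  by constructor 2.
have RG : R = gaussian_integers.
  by apply: gaussian_of_i => //; rewrite -dh; case: (HR Hh) => _ [].
have key (m1 m2 : C) : sqnorm m1 = 1 -> sqnorm m2 = 1 -> m1 * m2 = 0 +i* 1 ->
    R (m1 + m2) -> exists a : int, m1 + m2 = a%:~R * (1 +i* 1).
  rewrite RG => u1 u2 mm [a _ [b _ E]].
  have cE : (m1 + m2)^*%C * (0 +i* 1) = m1 + m2.
    have m10 : m1 != 0 by apply/eqP => m0; move: u1; rewrite m0 /sqnorm !cxE; lra.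
    have m20 : m2 != 0 by apply/eqP => m0; move: u2; rewrite m0 /sqnorm !cxE; lra.
    by rewrite rmorphD /= !conj_inv_unit // -mm; field; apply/andP.
  have ab : b%:~R = a%:~R :> K.
    by move: (congr1 (@complex.Re K) cE); rewrite -E /=; lra.
  by exists a; rewrite -E ab; apply: cxP; rewrite !cxE /=; ring.
have [a aE] : exists a : int, l1 + l2 = a%:~R * (1 +i* 1).
  by apply: key => //; rewrite -dE dh.
have [b bE] : exists b : int, zeta6 * l1 + zeta6^-1 * l2 = b%:~R * (1 +i* 1).
  have nz : sqnorm zeta6 = 1 by exact: (sqnorm_root _ z6).
  have nzV : sqnorm zeta6^-1 = 1.
    by rewrite zV; apply: (@sqnorm_root _ _ 6) => //; rewrite -exprM mulnC exprM z6 expr1n.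
  apply: key => //; rewrite ?sqnormM ?nz ?nzV ?mul1r //.
  by rewrite mulrACA divff // mul1r -dE dh.
have E : sqnorm (l1 + l2) + sqnorm (zeta6 * l1 + zeta6^-1 * l2)
     + sqnorm ((zeta6 * l1 + zeta6^-1 * l2) - (l1 + l2)) = 6.
  have s3 := @sqrt3_sqr K.
  transitivity (3 * sqnorm l1 + 3 * sqnorm l2 : K); last by rewrite n1 n2; ring.
  rewrite zeta6_inv zeta6E /sqnorm !cxE /=.
  set x1 := complex.Re l1; set y1 := complex.Im l1.
  set x2 := complex.Re l2; set y2 := complex.Im l2.
  transitivity (3 / 2 * ((x1 + x2) ^+ 2 + (y1 + y2) ^+ 2)
              + sqrt3 ^+ 2 / 2 * ((x1 - x2) ^+ 2 + (y1 - y2) ^+ 2) : K).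
    by field.
  by rewrite s3; field.
move: E; rewrite aE bE -mulrBl -rmorphB /= !sqnormM.
have -> : sqnorm (1 +i* 1 : C) = 2 by rewrite /sqnorm /=; ring.
have sqi (m : int) : sqnorm (m%:~R : C) = (m * m)%:~R.
  by rewrite /sqnorm !cxE rmorphM /=; ring.
rewrite !sqi -!mulrDl -!rmorphD /= => E.
have : (a * a + b * b + (b - a) * (b - a))%:~R = 3%:~R :> K by move: E; lra.
by move/eqP; rewrite eqr_int => /eqP; lia.
Qed.

(** The combination sqrt(-3) l1 of the traces of h and gh lies in R and has
    norm 3, so l1 is a power of zeta6. *)
Lemma classify_commuting_eisenstein h : H h ->
  determinant @` H = cyclic_gen (\det h) ->
  \det h = zeta6 \/ \det h = zeta6 ^+ 2 -> h * g = g ^+ 1 * h ->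
  exists (i : nat) (h : 'M[C]_2),
    [/\ (1 <= i <= 7)%N, C6_setting R H g h & HC6 i R H g h].
Proof.
move=> Hh Hd dh hg.
have nd : normalized_det (\det h).
  by case: dh => ->; [constructor 3|constructor 4].
have Rd : R (\det h) by case: (HR Hh) => _ [].
have Rz : R zeta6.
  case: dh => dE; first by rewrite -dE.
  have -> : zeta6 = \det h + 1 by rewrite dE zeta6_sqr subrK.
  by apply: (srD Rs) => //; exact: sr1.
have RE := eisenstein_of_zeta6 Ro Rz.
have RZV : R zeta6^-1 by rewrite zV; exact: srX.
have [l1 [l2 [hE dE n1 n2 [RT0 RT1]]]] := commuting_parts Hh nd hg.
have eisl : eisenstein (theta * l1).
  rewrite -RE; have -> : theta * l1 = (zeta6 * l1 + zeta6^-1 * l2) - zeta6^-1 * (l1 + l2).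
    by rewrite theta_zeta6 zeta6_inv; ring.
  by apply: (srB Rs) => //; exact: (srM Rs).
have [|k lE] := eisenstein_norm3 eisl.
  rewrite sqnormM n1 mulr1 /sqnorm thetaE /= expr0n add0r; exact: sqrt3_sqr.
have {}lE : l1 = zeta6 ^+ k by apply: (mulfI (@theta_neq0 K)).
(* g ^+ (k * 5) is g ^- k, which turns l1 into 1 *)
have tw m : h * g ^+ (k * 5 + m) = eigen_mx g (zeta6 ^+ m) (\det h * zeta6^-1 ^+ m).
  rewrite hE powg eigen_mxM //; congr eigen_mx.
    rewrite lE -exprD (_ : (_ + _ = 6 * k + m)%N); last by lia.
    by rewrite exprD exprM z6 expr1n mul1r.
  rewrite -hE dE lE [_ * l2]mulrC -!mulrA; congr (_ * _).
  rewrite zV -!exprM -exprD (_ : (5 * (k * 5 + m) = 6 * (4 * k) + (k + 5 * m))%N); last by lia.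
  by rewrite exprD exprM z6 expr1n mul1r.
case: dh => dE'.
- have [Hh' dh' Hd' hg'] := twist (k * 5 + 2) Hh Hd hg.
  have e2 : zeta6 * zeta6^-1 ^+ 2 = zeta6^-1 by rewrite expr2 mulrA divff ?mul1r.
  rewrite tw dE' e2 in Hh' dh' Hd' hg'.
  apply: (HC6_of_extension (i := 7) (k := 6) (e := 1) _ Hh' Hd' _ hg' isT); last first.
    by rewrite dh'; exact: has_order_zeta6.
  move=> ext; rewrite RE -ring_of_integers3; apply: HC6_7 => //.
    by rewrite eigen_mx_tr.
  by rewrite eigen_mxX // exprVn -exprM mulnC exprM z6 expr1n invr1 eigen_mx_scalar.
(* h g^(4-k) is the scalar zeta6^4, whose square is zeta6^2 *)
- have [Hh' _ _ _] := twist (k * 5 + 4) Hh Hd hg.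
  have e4 : zeta6 ^+ 2 * zeta6^-1 ^+ 4 = zeta6 ^+ 4.
    by rewrite zV -exprM -exprD -(expr_mod _ z6).
  have sqE : (h * g ^+ (k * 5 + 4)) ^+ 2 = (zeta6 ^+ 2)%:M.
    by rewrite tw dE' e4 eigen_mx_scalar scalar2X -exprM -(expr_mod _ z6).
  have Hs2 : H (zeta6 ^+ 2)%:M by rewrite -sqE; exact: HX.
  have ds2 : \det ((zeta6 ^+ 2)%:M : 'M[C]_2) = (\det h)^-1.
    rewrite det_scalar dE' -exprVn zV -!exprM.
    by rewrite -[LHS](expr_mod _ z6) -[RHS](expr_mod _ z6).
  have Hd2 : determinant @` H = cyclic_gen (\det ((zeta6 ^+ 2)%:M : 'M[C]_2)).
    by rewrite ds2 cyclic_gen_inv.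
  have hg2 : (zeta6 ^+ 2)%:M * g = g ^+ 1 * (zeta6 ^+ 2)%:M.
    by rewrite expr1 -[LHS]/(_ *m _) mul_scalar_mx -mul_mx_scalar.
  have h3 : ((zeta6 ^+ 2)%:M : 'M[C]_2) ^+ 3 = 1 by rewrite scalar2X -exprM z6.
  apply: (HC6_of_extension (i := 4) (k := 3) (e := 1) _ Hs2 Hd2 _ hg2 isT).
    move=> ext; rewrite RE -ring_of_integers3.
    exact: (HC6_4 tg (erefl _) h3 ext).
  rewrite ds2 dE'; apply: has_orderV.
  exact: (@has_orderX _ _ 3 2) has_order_zeta6.
Qed.

Lemma C6_classification h0 : H h0 -> determinant @` H = cyclic_gen (\det h0) ->
  \det h0 != 1 ->
  exists (i : nat) (h : 'M[C]_2),
    [/\ (1 <= i <= 7)%N, C6_setting R H g h & HC6 i R H g h].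
Proof.
move=> Hh0 Hd0 d1.
have [h [Hh Hd nd]] : exists h, [/\ H h, determinant @` H = cyclic_gen (\det h)
    & normalized_det (\det h)].
  have [E|nd|nd] := unit_or_inv_normalized Ro (HR Hh0).2.
  - by rewrite E eqxx in d1.
  - by exists h0.
  - exists h0^-1; rewrite det2V; split=> //; first exact: HV.
    by rewrite cyclic_gen_inv.
have [hg|hg] := normalizes_cases Hh; last exact: (classify_inverting Hh).
case: (nd) => dE.
- exact: (classify_commuting_N1 Hh).
- by case: (no_commuting_imaginary Hh hg dE).
- by apply: (classify_commuting_eisenstein Hh) => //; left.
- by apply: (classify_commuting_eisenstein Hh) => //; right.
Qed.

End Classification.

(** * Existence *)

Section Existence.
Context {K : realType}.
Local Notation C := K[i].
Local Notation zeta6 := (@zeta6 K).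
Local Notation zeta12 := (@zeta12 K).
Implicit Types (R : set C).

Definition mx2 (a b c d : C) : 'M[C]_2 :=
  \matrix_(i, j) if i == 0 then (if j == 0 then a else b)
                 else (if j == 0 then c else d).

Lemma mx2_entries a b c d : (mx2 a b c d 0 0 = a) * (mx2 a b c d 0 1 = b) *
  (mx2 a b c d 1 0 = c) * (mx2 a b c d 1 1 = d).
Proof. by rewrite !mxE. Qed.

Lemma tr_mx2 a b c d : \tr (mx2 a b c d) = a + d.
Proof. by rewrite tr2E !mx2_entries. Qed.

Lemma det_mx2 a b c d : \det (mx2 a b c d) = a * d - b * c.
Proof. by rewrite det2E !mx2_entries. Qed.

Lemma GL2_mx2 R a b c d : is_subring R -> R a -> R b -> R c -> R d ->
  R (a * d - b * c)^-1 -> a * d - b * c != 0 -> GL2 R (mx2 a b c d).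
Proof.
move=> Rs Ra Rb Rc Rd RV d0; split.
  by move=> i j; case: (ord2E i) => ->; case: (ord2E j) => ->; rewrite mx2_entries.
rewrite det_mx2; split; first by apply: (srB Rs); exact: (srM Rs).
by exists (a * d - b * c)^-1 => //; rewrite divff.
Qed.

Lemma gaussian_subring : is_subring (@gaussian_integers K).
Proof.
split.
- by exists 1 => //; exists 0.
- move=> _ _ [a _ [b _ <-]] [a' _ [b' _ <-]].
  by exists (a - a') => //; exists (b - b') => //; rewrite !rmorphB.
- move=> _ _ [a _ [b _ <-]] [a' _ [b' _ <-]].
  exists (a * a' - b * b') => //; exists (a * b' + b * a') => //.
  by rewrite !(rmorphB, rmorphD, rmorphM).
Qed.

Lemma exists_HC6_1 : exists (H : set 'M[C]_2) (g h : 'M[C]_2),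
  C6_setting gaussian_integers H g h /\ HC6 1 gaussian_integers H g h.
Proof.
(* the companion matrix of X^2 - i X - 1, with roots zeta12 and zeta12^5 *)
pose h := mx2 0 1 1 (0 +i* 1).
have Rs := gaussian_subring.
have dh : \det h = -1 by rewrite det_mx2; ring.
have th : \tr h = 0 +i* 1 by rewrite tr_mx2 add0r.
have tg : \tr (h ^+ 2) = 1.
  rewrite Cayley_Hamilton2 raddfB /= mxtraceZ mxtrace_scalar th dh -expr2 imaginary_sqr.
  by ring.
have dg : \det (h ^+ 2) = 1 by rewrite det2X dh sqrrN expr1n.
have ext : cyclic_extension 6 2 1 (h ^+ 2) h.
  apply: extension_of_det => //.
  - by rewrite expr1 -exprS -exprSr.
  - by rewrite dh; exact: has_orderN1.
  - exact: (@cyclic_genX _ _ 1).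
have GLh : GL2 gaussian_integers h.
  apply: GL2_mx2 => //; try exact: sr0; try exact: sr1.
  - by exists 0 => //; exists 1.
  - rewrite (_ : _ - _ = -1) ?invrN1; last by ring.
    by apply: (srN Rs); exact: sr1.
  - by rewrite (_ : _ - _ = -1) ?oppr_eq0 ?oner_eq0 //; ring.
exists (Defs.generated [set h ^+ 2; h]), (h ^+ 2), h; split.
  apply: (extension_C6_setting dg _ ext) => //; first by rewrite dh; exact: has_orderN1.
  have [_ _ GM _] := GL2_subgroup Rs.
  by rewrite expr2; exact: GM.
exact: HC6_1.
Qed.

Section OverEisenstein.
Let R := @ring_of_integers K 3.
Let Rs : is_subring R.
Proof. by rewrite /R ring_of_integers3; exact: eisenstein_subring. Qed.
Let Rz : R zeta6.
Proof. by rewrite /R ring_of_integers3; exact: eisenstein_zeta6. Qed.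
Let z6 : zeta6 ^+ 6 = 1. Proof. by case: (@has_order_zeta6 K). Qed.
Let z0 := @zeta6_neq0 K.
Let RzV : R zeta6^-1.
Proof. by rewrite zeta6_inv; apply: (srB Rs) => //; exact: sr1. Qed.

Let g := mx2 zeta6 0 0 zeta6^-1.
Let tg : \tr g = 1. Proof. by rewrite tr_mx2 zeta6_inv addrC subrK. Qed.
Let dg : \det g = 1. Proof. by rewrite det_mx2 mulr0 subr0 divff. Qed.

Let GLdiag a b : R a -> R b -> a * b != 0 -> R (a * b)^-1 -> GL2 R (mx2 a 0 0 b).
Proof.
move=> Ra Rb ab0 RV.
by apply: GL2_mx2 => //; rewrite ?mulr0 ?subr0 //; exact: sr0.
Qed.

Let GLg : GL2 R g.
Proof.
apply: GLdiag => //; rewrite divff ?oner_eq0 ?invr1 //; exact: sr1.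
Qed.

Let diag_comm a b a' b' : mx2 a 0 0 b * mx2 a' 0 0 b' = mx2 a' 0 0 b' ^+ 1 * mx2 a 0 0 b.
Proof. by rewrite expr1; apply: mx2P; rewrite !mul2E !mx2_entries; ring. Qed.

Let diagX a b n : mx2 a 0 0 b ^+ n = mx2 (a ^+ n) 0 0 (b ^+ n).
Proof.
elim: n => [|n IH].
  by rewrite !expr0; apply: mx2P; rewrite !mx2_entries one2E.
by rewrite !exprS IH; apply: mx2P; rewrite !mul2E !mx2_entries; ring.
Qed.

Let diag11 : mx2 1 0 0 1 = 1.
Proof. by apply: mx2P; rewrite !mx2_entries one2E. Qed.

Lemma exists_HC6_2 : exists (H : set 'M[C]_2) (g h : 'M[C]_2),
  C6_setting (ring_of_integers 3) H g h /\ HC6 2 (ring_of_integers 3) H g h.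
Proof.
pose h := mx2 1 0 0 (-1).
have dh : \det h = -1 by rewrite det_mx2; ring.
have th : \tr h = 0 by rewrite tr_mx2 subrr.
have h2 : h ^+ 2 = 1 by rewrite diagX expr1n sqrrN expr1n diag11.
have ext : cyclic_extension 6 2 1 g h.
  apply: extension_of_det => //; first exact: diag_comm.
    by rewrite dh; exact: has_orderN1.
  by rewrite h2; exact: (@cyclic_genX _ _ 0).
exists (Defs.generated [set g; h]), g, h; split.
  apply: (extension_C6_setting dg _ ext) => //; first by rewrite dh; exact: has_orderN1.
  have R1 := sr1 Rs; have RN1 := srN Rs R1.
  by apply: GLdiag => //; rewrite mul1r ?invrN1 // oppr_eq0 oner_eq0.
by apply: HC6_2 => //; left.
Qed.

Lemma exists_HC6_7 : exists (H : set 'M[C]_2) (g h : 'M[C]_2),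
  C6_setting (ring_of_integers 3) H g h /\ HC6 7 (ring_of_integers 3) H g h.
Proof.
pose h := mx2 (zeta6 ^+ 2) 0 0 zeta6^-1.
have z2V : zeta6 ^+ 2 * zeta6^-1 = zeta6 by rewrite expr2 mulfK.
have dh : \det h = zeta6 by rewrite det_mx2 mulr0 subr0 z2V.
have th : \tr h = zeta6 ^+ 2 + zeta6^-1 by rewrite tr_mx2.
have h6 : h ^+ 6 = 1.
  by rewrite diagX exprVn -exprM mulnC exprM z6 expr1n invr1 diag11.
have ext : cyclic_extension 6 6 1 g h.
  apply: extension_of_det => //; first exact: diag_comm.
    by rewrite dh; exact: has_order_zeta6.
  by rewrite h6; exact: (@cyclic_genX _ _ 0).
exists (Defs.generated [set g; h]), g, h; split.
  apply: (extension_C6_setting dg _ ext) => //; first by rewrite dh; exact: has_order_zeta6.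
  by apply: GLdiag => //; rewrite ?z2V //; exact: srX.
exact: HC6_7.
Qed.

Lemma exists_SL2_tr1 : exists g : 'M[C]_2, SL2 (ring_of_integers 3) g /\ \tr g = 1.
Proof.
by exists g; split.
Qed.

Lemma exists_HC6_4 (g' : 'M[C]_2) : SL2 (ring_of_integers 3) g' -> \tr g' = 1 ->
  exists (H : set 'M[C]_2) (h : 'M[C]_2),
    C6_setting (ring_of_integers 3) H g' h /\ HC6 4 (ring_of_integers 3) H g' h.
Proof.
move=> [GLg' dg'] tg'; pose h : 'M[C]_2 := (zeta6 ^+ 2)%:M.
have ow : has_order (zeta6 ^+ 2) 3 by exact: (@has_orderX _ _ 3 2) has_order_zeta6.
have dh : \det h = (zeta6 ^+ 2)^-1.
  have [_ w3 _] := ow; rewrite det_scalar; apply: (mulfI (expf_neq0 2 z0)).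
  by rewrite divff ?expf_neq0 // -exprS.
have odh : has_order (\det h) 3 by rewrite dh; exact: has_orderV.
have h3 : h ^+ 3 = 1 by rewrite scalar2X; case: ow => _ ->.
have ext : cyclic_extension 6 3 1 g' h.
  apply: extension_of_det => //.
    by rewrite expr1 -[LHS]/(_ *m _) mul_scalar_mx -mul_mx_scalar.
  by rewrite h3; exact: (@cyclic_genX _ _ 0).
exists (Defs.generated [set g'; h]), h; split; last exact: HC6_4.
apply: (extension_C6_setting dg' odh ext) => //.
have hE : h = mx2 (zeta6 ^+ 2) 0 0 (zeta6 ^+ 2).
  by apply: mx2P; rewrite !mx2_entries scalar2E.
have Rw := srX Rs 2 Rz.
rewrite hE; apply: GLdiag => //; first by rewrite mulf_neq0 ?expf_neq0.
by rewrite -exprD -exprVn; exact: srX.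
Qed.

End OverEisenstein.

Section Antidiagonal.
Let g := mx2 0 (-1) 1 1.
Let tg : \tr g = 1. Proof. by rewrite tr_mx2 add0r. Qed.
Let dg : \det g = 1. Proof. by rewrite det_mx2; ring. Qed.

(** Exchanging the coordinates inverts the companion matrix of X^2 - X + 1,
    and a factor c gives the determinant - c^2. *)
Lemma antidiagonal_extension (F : set C) (c : C) k : is_subfield F -> F c ->
  has_order (- (c * c)) k -> cyclic_gen g (mx2 0 c c 0 ^+ k) ->
  [/\ is_subgroup (Defs.generated [set g; mx2 0 c c 0]),
      Defs.generated [set g; mx2 0 c c 0] `<=` GL2 F,
      cyclic_extension 6 k 5 g (mx2 0 c c 0),
      \tr (mx2 0 c c 0) = 0 & \det (mx2 0 c c 0) = - (c * c)].
Proof.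
move=> Ff Fc oc hk; set h := mx2 0 c c 0.
have Fs := is_subfield_subring Ff.
have dh : \det h = - (c * c) by rewrite det_mx2; ring.
have ext : cyclic_extension 6 k 5 g h.
  apply: extension_of_det => //; last by rewrite dh.
  rewrite tr1_pow5 //; apply: mx2P; rewrite !mul2E !add2E !opp2E !one2E !mx2_entries; ring.
have F0 := sr0 Fs; have F1 := sr1 Fs.
have FV x : F x -> F x^-1 by case: Ff => _ _ Fd Fx; rewrite -[_^-1]mul1r; exact: Fd.
split=> //; last by rewrite tr_mx2 addr0.
  by rewrite (metacyclic_generated ext); exact: metacyclic_subgroup ext.
apply: generated_sub; first exact: GL2_subgroup.
move=> _ [->|->].
  have d1 : 0 * 1 - (-1) * 1 = 1 :> C by ring.
  apply: (GL2_mx2 Fs F0 (srN Fs F1) F1 F1); first by rewrite d1 invr1.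
  by rewrite d1 oner_eq0.
apply: (GL2_mx2 Fs F0 Fc Fc F0).
  by apply: (FV); apply: (srB Fs); exact: (srM Fs).
rewrite mulr0 sub0r; have [k0 ck _] := oc; apply: contra_eq_neq ck => ->.
by rewrite expr0n gtn_eqF // eq_sym oner_eq0.
Qed.

Let antidiag_sqr c : mx2 0 c c 0 ^+ 2 = (c * c)%:M.
Proof. by apply: mx2P; rewrite expr2 !mx2E !mx2_entries; ring. Qed.

Lemma exists_presented3 d : exists H : set 'M[C]_2,
  is_subgroup H /\ H `<=` GL2 (Q_sqrtN d) /\ presented3 H.
Proof.
have h2 : mx2 0 1 1 0 ^+ 2 = 1 by rewrite antidiag_sqr mulr1.
have Ff := Q_adjoin_subfield [set (sqrtN d : C)].
have [|||Hs HGL ext th dh] := @antidiagonal_extension _ 1 2 Ff.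
- by case: Ff.
- by rewrite mulr1; exact: has_orderN1.
- by rewrite h2; exact: (@cyclic_genX _ _ 0).
exists (Defs.generated [set g; mx2 0 1 1 0]); split=> //; split=> //.
exact: metacyclic_presented3.
Qed.

Lemma exists_presented5 : exists H : set 'M[C]_2,
  is_subgroup H /\ H `<=` GL2 Q_sqrt2_i /\ presented5 H.
Proof.
pose r : C := (Num.sqrt (2 : K))%:C; pose i : C := 0 +i* 1.
have r2 : r ^+ 2 = 2.
  by rewrite /r -rmorphXn /= sqr_sqrtr ?ler0n // rmorph_nat.
have i2 : i ^+ 2 = -1 by exact: imaginary_sqr.
have r0 : r != 0 by rewrite -sqrf_eq0 r2 pnatr_eq0.
(* a square root of -i *)
pose c : C := (1 - i) / r.
have cc : - (c * c) = i.
  transitivity (- ((1 - i *+ 2 + i ^+ 2) / r ^+ 2)); first by rewrite /c; field.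
  by rewrite i2 r2; field.
have Ff : is_subfield (Q_sqrt2_i : set C) by exact: Q_adjoin_subfield.
have Fc : Q_sqrt2_i c.
  have [F1 FB FD] := Ff.
  apply: FD; last by apply: Q_adjoin_gen; left.
  by apply: FB => //; apply: Q_adjoin_gen; right.
have h4 : mx2 0 c c 0 ^+ 4 = g ^+ 3.
  rewrite (exprM _ 2 2) antidiag_sqr scalar2X tr1_cube //.
  by rewrite -[c * c]opprK cc sqrrN i2 raddfN.
have [||Hs HGL ext th dh] := @antidiagonal_extension _ c 4 Ff Fc.
- by rewrite cc; exact: has_order_imaginary.
- by rewrite h4; exact: cyclic_genX.
exists (Defs.generated [set g; mx2 0 c c 0]); split=> //; split=> //.
exact: metacyclic_presented5.
Qed.

Lemma exists_presented6 : exists H : set 'M[C]_2,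
  is_subgroup H /\ H `<=` GL2 (Q_sqrtN 3) /\ presented6 H.
Proof.
(* a square root of - zeta6 *)
pose c : C := zeta6 ^+ 2.
have z3 := @zeta6_cube K.
have cc : - (c * c) = zeta6.
  by rewrite /c -exprD exprS z3 mulrN1 opprK.
have Ff := Q_adjoin_subfield [set (sqrtN 3 : C)].
have Fc : Q_sqrtN 3 c.
  have : ring_of_integers 3 c.
    by rewrite ring_of_integers3; apply: srX; [exact: eisenstein_subring | exact: eisenstein_zeta6].
  by case.
have h6 : mx2 0 c c 0 ^+ 6 = 1.
  rewrite (exprM _ 2 3) antidiag_sqr scalar2X -[c * c]opprK cc exprNn z3.
  by rewrite -signr_odd mulN1r opprK.
have [||Hs HGL ext th dh] := @antidiagonal_extension _ c 6 Ff Fc.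
- by rewrite cc; exact: has_order_zeta6.
- by rewrite h6; exact: (@cyclic_genX _ _ 0).
exists (Defs.generated [set g; mx2 0 c c 0]); split=> //; split=> //.
exact: metacyclic_presented6.
Qed.

End Antidiagonal.
End Existence.

Theorem corollary37 (K : realType) :
  (forall (R : set K[i]) (H : set 'M[K[i]]_2) (g h0 : 'M[K[i]]_2)
          (r s : nat) (l1 l2 : K[i]),
     is_elliptic_End R ->
     finite_subgroup H (GL2 R) ->
     H `&` SL2 R = cyclic_gen g ->
     isomorphic (cyclic_gen g) (Zp 6) ->
     H h0 -> has_order h0 r ->
     determinant @` H = cyclic_gen (\det h0) ->
     isomorphic (cyclic_gen (\det h0)) (Zp s) ->
     (1 < s)%N ->
     eigenvalues h0 l1 l2 ->
     exists (i : nat) (h : 'M[K[i]]_2),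
       [/\ (1 <= i <= 7)%N, C6_setting R H g h & HC6 i R H g h])
  /\
  [/\ exists (H : set 'M[K[i]]_2) (g h : 'M[K[i]]_2),
        C6_setting gaussian_integers H g h /\ HC6 1 gaussian_integers H g h,
      exists (H : set 'M[K[i]]_2) (g h : 'M[K[i]]_2),
        C6_setting (ring_of_integers 3) H g h /\
        HC6 2 (ring_of_integers 3) H g h,
      (exists g : 'M[K[i]]_2, SL2 (ring_of_integers 3) g /\ \tr g = 1) /\
      (forall g : 'M[K[i]]_2, SL2 (ring_of_integers 3) g -> \tr g = 1 ->
        exists (H : set 'M[K[i]]_2) (h : 'M[K[i]]_2),
          C6_setting (ring_of_integers 3) H g h /\
          HC6 4 (ring_of_integers 3) H g h)
    & exists (H : set 'M[K[i]]_2) (g h : 'M[K[i]]_2),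
        C6_setting (ring_of_integers 3) H g h /\
        HC6 7 (ring_of_integers 3) H g h]
  /\
  [/\ forall d : nat, (0 < d)%N ->
        exists H : set 'M[K[i]]_2,
          is_subgroup H /\ H `<=` GL2 (Q_sqrtN d) /\ presented3 H,
      exists H : set 'M[K[i]]_2,
        is_subgroup H /\ H `<=` GL2 Q_sqrt2_i /\ presented5 H
    & exists H : set 'M[K[i]]_2,
        is_subgroup H /\ H `<=` GL2 (Q_sqrtN 3) /\ presented6 H].
Proof.
split; last split.
- move=> R H g h0 r s l1 l2 Rell Hfs HS isog Hh0 _ Hd isos s1 _.
  apply: (C6_classification (elliptic_End_is_order Rell) Hfs HS isog Hh0 Hd).
  exact: has_order_expr1 s1 (isomorphic_has_order s1 isos).
- split; [exact: exists_HC6_1 | exact: exists_HC6_2 | | exact: exists_HC6_7].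
  by split; [exact: exists_SL2_tr1 | exact: exists_HC6_4].
- split; [ | exact: exists_presented5 | exact: exists_presented6].
  by move=> d _; exact: exists_presented3.
Qed.
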